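(* Let $\mathcal X$ be a translation invariant simple random point process on $\mathbb R$ whose one- and two-point correlation functions satisfy $\rho_1\equiv 1$ and $\rho_2(x,y)=1-T_2(x-y)$ for some function $T_2:\mathbb R\to\mathbb R$. Assume: 1) $\sup_{v\in\mathbb R}|T_2(v)|<\infty$; 2) there exists a sequence $\{\alpha_N\}_{N\ge 1}$ with $\log N\ll\alpha_N\ll N^{1/2-\varepsilon}$ as $N\to\infty$ (for some $\varepsilon>0$) such that, uniformly in $A\in[\alpha_N,N-\alpha_N]$, $$\int_{\alpha_N}^{A}T_2(v)\log\left|2\sin\frac{\pi v}{N}\right|dv=o(1)\quad\text{as }N\to\infty .$$ Then the following hold. (a) If $\int_{-\infty}^{\infty}T_2(v)\log|v|\,dv<\infty$ (i.e. this integral converges) and $\int_{-\infty}^\infty T_2(v)\,dv=c\neq 1$, then $\mathbb E\,\mathcal W_N\to\infty$ as $N\to\infty$. (b) If $\int_{-\infty}^\infty T_2(v)\,dv=1$ and $1-\int_{-\alpha_N}^{\alpha_N}T_2(v)\,dv=o\big((\log N)^{-1}\big)$ for $\{\alpha_N\}$ as in 2), then $\lim_{N\to\infty}\mathbb E\,\mathcal W_N$ exists and is finite if and only if $\int_{-\infty}^\infty T_2(v)\log|v|\,dv$ converges, and in that case $$\lim_{N\to\infty}\mathbb E\,\mathcal W_N=\log 2\pi+\int_{-\infty}^{\infty}\log|v|\,T_2(v)\,dv .$$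
   Context: A simple random point process on $\mathbb R$ is a random locally finite set $\{a_i\}$ of mutually distinct points of $\mathbb R$. Its $k$-point correlation function $\rho_k$ is characterized by $\mathbb E\sum_{i_1,\dots,i_k\text{ pairwise distinct}}F(a_{i_1},\dots,a_{i_k})=\int_{\mathbb R^k}F\rho_k\,dx_1\cdots dx_k$ for suitable test functions $F$. The correlation functions are assumed to exist (absolutely continuous correlation measures). Integrals over $\mathbb R$ may be improper. For a configuration $\{a_i\}$ and $N\ge 1$, the renormalized energy at scale $N$ is $$\mathcal W_N=-\frac1N\sum_{i\ne j,\ a_i,a_j\in[0,N]}\log\left|2\sin\frac{\pi(a_i-a_j)}{N}\right|+\log N .$$ The notation $f_N\ll g_N$ means $f_N=o(g_N)$ as $N\to\infty$. *)

(* Defs.v *)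
From HB Require Import structures.
From mathcomp Require Import all_boot all_order all_algebra.
From mathcomp Require Import all_classical all_reals all_analysis.
From mathcomp Require Import measurable_realfun.
Set Implicit Arguments.
Unset Strict Implicit.
Unset Printing Implicit Defensive.
Import Order.TTheory GRing.Theory Num.Theory.
Import numFieldNormedType.Exports.
Local Open Scope classical_set_scope.
Local Open Scope ring_scope.

(* The counting events {A : #(A ∩ B) = n}, B Borel; they generate the usual
   sigma-algebra on the space of configurations. *)
Definition count_events (R : realType) : set (set (set R)) :=
  [set E | exists2 B : set R, measurable B &
           exists n : nat, E = [set A | counting (A `&` B) = (n%:R : R)%:E]].

Definition config (R : realType) := g_sigma_algebraType (@count_events R).

(* A configuration is a set, so its points are automatically distinct. *)
Definition simple_point_process (R : realType) (d : measure_display)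
    (T : measurableType d) (X : T -> config R) : Prop :=
  (forall (w : T) (a b : R), finite_set (X w `&` `[a, b])) /\
  measurable_fun [set: T] X.

Definition translate (R : realType) (t : R) (A : config R) : config R :=
  [set a + t | a in A].

Definition translation_invariant (R : realType) (d : measure_display)
    (T : measurableType d) (P : probability T R) (X : T -> config R) : Prop :=
  forall (t : R) (E : set (config R)), measurable E ->
    P ((translate t \o X) @^-1` E) = P (X @^-1` E).

(* Lebesgue integral over R^k, written as an iterated integral; it is only used
   for nonnegative measurable integrands, for which this is Tonelli's theorem. *)
Fixpoint integral_tuple (R : realType) (k : nat) :
    (k.-tuple R -> \bar R) -> \bar R :=
  match k with
  | 0 => fun F => F [tuple]
  | k'.+1 => fun F =>
      (\int[lebesgue_measure]_x
         integral_tuple (fun t : k'.-tuple R => F [tuple of x :: t]))%E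
  end.

Definition distinct_tuples (R : realType) (k : nat) (A : set R) :
    set (k.-tuple R) :=
  [set t : k.-tuple R | uniq t /\ forall i : 'I_k, A (tnth t i)].

(* The test functions are all Borel F : R^k -> [0, +oo], and the identity is one
   in [0, +oo]. *)
Definition correlation_function (R : realType) (d : measure_display)
    (T : measurableType d) (P : probability T R) (X : T -> config R)
    (k : nat) (rho : k.-tuple R -> R) : Prop :=
  [/\ measurable_fun [set: k.-tuple R] rho,
      forall t, 0 <= rho t &
      forall F : k.-tuple R -> \bar R,
        measurable_fun [set: k.-tuple R] F -> (forall t, 0 <= F t)%E ->
        (\int[P]_w (\esum_(t in distinct_tuples (X w)) F t) =
         integral_tuple (fun t => F t * (rho t)%:E))%E].

(* The sum is over ordered pairs.  [ln 0 = 0], so the pair (0, N), for which the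
   sine vanishes, contributes 0; when the one-point correlation function exists
   this concerns an event of probability 0. *)
Definition renormalized_energy (R : realType) (N : nat) (A : set R) : R :=
  let AN := A `&` `[0, N%:R] in
  - N%:R^-1 *
    (\sum_(p \in (AN `*` AN) `&` [set p : R * R | p.1 != p.2])
        ln `|2 * sin (pi * (p.1 - p.2) / N%:R)|) +
  ln N%:R.

(* [f] is Lebesgue integrable on compact intervals and its improper integral
   over the real line converges to [l], separately at both ends. *)
Definition improper_integral (R : realType) (f : R -> R) (l : R) : Prop :=
  (forall a b : R, lebesgue_measure.-integrable `[a, b] (EFin \o f)) /\
  exists lm lp : R,
    [/\ (\int[lebesgue_measure]_(v in `[- A, 0]) f v) @[A --> +oo] --> lm,
        (\int[lebesgue_measure]_(v in `[0, A]) f v) @[A --> +oo] --> lp &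
        l = lm + lp].

Definition improper_converges (R : realType) (f : R -> R) : Prop :=
  exists l : R, improper_integral f l.

(* Main.v *)
Require Import Defs.
From HB Require Import structures.
From mathcomp Require Import all_boot all_order all_algebra.
From mathcomp Require Import all_classical all_reals all_analysis.
From mathcomp Require Import measurable_realfun.
From mathcomp Require Import ring lra.
Set Implicit Arguments.
Unset Strict Implicit.
Unset Printing Implicit Defensive.
Import Order.TTheory GRing.Theory Num.Theory.
Import numFieldNormedType.Exports.
Local Open Scope classical_set_scope.
Local Open Scope ring_scope.

(* Write L(v) = log |2 sin(pi v / N)| and H(x) for the integral of L T2 over
   [0, x].  Applying the definition of the correlation functions to L and using
   that L has mean zero gives
     E W_N = log N + N^-1 * \int_0^N (H(x) + H(N - x)) dx.
   By assumption 2, H is within o(1) of H(alpha_N) on [alpha_N, N - alpha_N]; the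
   two end pieces contribute O(alpha_N^2 log N / N) = o(1), and on [0, alpha_N]
   the function L(v) is log (2 pi v / N) up to O((alpha_N / N)^2).  Hence, with
   Psi and Phi the integrals of T2 and T2 log over [0, alpha_N],
     E W_N = log N (1 - 2 Psi) + 2 log(2 pi) Psi + 2 Phi + o(1),
   and T2 is symmetric, as the sum over ordered pairs is.  In (a), c <= 1 because
   the number of points in an interval has nonnegative variance.  For the converse
   in (b), log v / (- L(v)) is nondecreasing and bounded on [alpha_N, sqrt N], so
   by Bonnet's inequality assumption 2 also controls the integral of T2 log over
   [alpha_N, A] uniformly in A <= sqrt N, and these windows cover all large A. *)

(** * Affine changes of variables *)

(** The correlation identities test nonnegative functions only, while L is unbounded below. Since L
    <= log 2, they are applied to the constant log 2 and to log 2 - L, and subtracted. The function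
    1 - [T2] enters only as a density, so its symmetry is available in integrated form: against an
    even weight, the integrals over [-A, 0] and [0, A] agree. This is also why Psi tends to c / 2.
    All errors are governed by alpha_N^2 log N / N, which tends to 0 because the spare factor N^(2
    eps) in the bound on alpha_N^2 beats log N. In the converse of (b) the obstacle is that [T2] has
    no sign: smallness of the integral of [T2] L says nothing about that of [T2] log by comparison
    of integrands, and a monotone quotient is needed. The cut at sqrt N serves this: there log v is
    at most half of log N, so - L is still of order log N and the quotient stays bounded. Conversely
    a large A lies in the window of any N just above A^2, because alpha_N is much smaller than sqrt
    N. *)

Section affine.
Context {R : realType}.
Local Notation mu := (@lebesgue_measure R).

Lemma measurable_affine (a b : R) :
  measurable_fun [set: R] (fun x => a * x + b).
Proof.
apply: measurable_funD; last exact: measurable_cst.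
by apply: measurable_funM => //; exact: measurable_cst.
Qed.

(** By uniqueness of Lebesgue measure it is enough to check half-open intervals. For [a < 0] the
    preimage of []u, v]] is half-open at the other end, hence the case split. *)
Lemma lebesgue_measure_affine (a b : R) (A : set R) : a != 0 -> measurable A ->
  (`|a|%:E * pushforward mu (fun x : R => (a * x + b)%R : measurableTypeR R) A = mu A)%E.
Proof.
move=> a0 mA; apply/esym.
have mphi := measurable_affine a b : measurable_fun _ (_ : R -> measurableTypeR R).
rewrite -[LHS]/(lebesgue_measure A).
apply: (@lebesgue_measure_unique R
  (mscale (NngNum (normr_ge0 a)) (pushforward mu _ : {measure set _ -> \bar R}))) => //.
move=> _ [[u v]] _ <-; rewrite /pushforward.
rewrite -[RHS]/(`|a|%:E * mu ((fun x : R => (a * x + b)%R) @^-1` `]u, v]%classic))%E /=.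
case: (ltgtP a 0) a0 => // a0 _.
- have -> : (fun x => a * x + b) @^-1` `]u, v]%classic = `[(v - b) / a, (u - b) / a[%classic.
    apply/seteqP; split=> x/=; rewrite !in_itv/= ler_ndivrMr// ltr_ndivlMr//;
    move=> /andP[? ?]; apply/andP; split; lra.
  rewrite !lebesgue_measure_itv/= !lte_fin ltr_ndivrMr// divfK ?lt_eqF// ltrD2r.
  case: ifPn => _; last by rewrite mule0.
  by rewrite -EFinB -EFinM ltr0_norm//; congr EFin; field; rewrite lt_eqF.
- have -> : (fun x => a * x + b) @^-1` `]u, v]%classic = `](u - b) / a, (v - b) / a]%classic.
    apply/seteqP; split=> x/=; rewrite !in_itv/= ler_pdivlMr// ltr_pdivrMr//;
    move=> /andP[? ?]; apply/andP; split; lra.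
  rewrite !lebesgue_measure_itv/= !lte_fin ltr_pdivrMr// divfK ?gt_eqF// ltrD2r.
  case: ifPn => _; last by rewrite mule0.
  by rewrite -EFinB -EFinM gtr0_norm//; congr EFin; field; rewrite gt_eqF.
Qed.

Lemma ge0_integral_affine (a b : R) (f : R -> \bar R) : a != 0 ->
  measurable_fun [set: R] f -> (forall x, 0 <= f x)%E ->
  (\int[mu]_x f (a * x + b)%R = `|a|^-1%:E * \int[mu]_x f x)%E.
Proof.
move=> a0 mf f0.
pose phi : R -> measurableTypeR R := fun x => a * x + b.
have mphi : measurable_fun [set: measurableTypeR R] phi by exact: measurable_affine.
rewrite -[LHS]/(\int[mu]_(x in phi @^-1` setT) (f \o phi) x)%E.
rewrite -(@ge0_integral_pushforward _ _ _ _ _ _ mphi)//.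
have -> : `|a|^-1 = (NngNum (normr_ge0 a^-1))%:num by rewrite /= normfV.
rewrite -ge0_integral_mscale//.
apply: eq_measure_integral => //= A mA _.
rewrite -[RHS]/(`|a^-1|%:E * mu A)%E -(lebesgue_measure_affine b a0 mA).
by rewrite muleA -EFinM normfV mulVf ?mul1e// normr_eq0.
Qed.

Lemma ge0_integral_affine_in (a b : R) (D : set R) (f : R -> \bar R) : a != 0 ->
  measurable D -> measurable_fun D f -> (forall x, D x -> 0 <= f x)%E ->
  (\int[mu]_(x in (fun x => a * x + b)%R @^-1` D) f (a * x + b)%R =
   `|a|^-1%:E * \int[mu]_(x in D) f x)%E.
Proof.
move=> a0 mD mf f0; rewrite integral_mkcond [in RHS]integral_mkcond.
rewrite -(ge0_integral_affine b)//.
- by apply/(measurable_restrictT f mD).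
- by move=> x; rewrite /patch; case: ifPn => // /set_mem/f0.
Qed.

Lemma integrable_affine (a b : R) (D : set R) (f : R -> \bar R) : a != 0 ->
  measurable D -> mu.-integrable D f ->
  mu.-integrable ((fun x => a * x + b) @^-1` D) (fun x => f (a * x + b)).
Proof.
move=> a0 mD /integrableP[mf fi]; apply/integrableP; split.
  apply: (@measurable_comp _ _ _ _ _ _ D) => //; first by move=> _ [x Dx <-].
  exact: measurable_funTS (measurable_affine a b).
rewrite (ge0_integral_affine_in b a0 mD (f := fun x => `|f x|%E))//.
  by rewrite lte_mul_pinfty// ?lee_fin ?invr_ge0.
exact: measurableT_comp.
Qed.

Lemma Rintegral_affine (a b : R) (D : set R) (f : R -> R) : a != 0 ->
  measurable D -> mu.-integrable D (EFin \o f) ->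
  \int[mu]_(x in (fun x => a * x + b) @^-1` D) f (a * x + b) =
  `|a|^-1 * \int[mu]_(x in D) f x.
Proof.
move=> a0 mD fi; have mf : measurable_fun D (EFin \o f) by case/integrableP: fi.
have pf : (\int[mu]_(x in D) (EFin \o f)^\+ x)%E \is a fin_num.
  exact: integrable_pos_fin_num.
have nf : (\int[mu]_(x in D) (EFin \o f)^\- x)%E \is a fin_num.
  exact: integrable_neg_fin_num.
rewrite /Rintegral -[X in X * _]/(fine `|a|^-1%:E) -fineM//; last exact: integrable_fin_num.
congr fine; rewrite integralE [in RHS]integralE muleBr//; last first.
  by rewrite -(fineK pf) -(fineK nf).
congr (_ - _)%E; rewrite -(ge0_integral_affine_in b)//.
- by apply: eq_integral => x _; rewrite !funeposE.
- exact: measurable_funepos.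
- by apply: eq_integral => x _; rewrite !funenegE.
- exact: measurable_funeneg.
Qed.

Lemma ge0_integral_reflect (c : R) (f : R -> \bar R) :
  measurable_fun [set: R] f -> (forall x, 0 <= f x)%E ->
  (\int[mu]_x f (c - x)%R = \int[mu]_x f x)%E.
Proof.
move=> mf f0; rewrite -[RHS]mul1e -(_ : (`|- 1 : R|^-1%:E = 1)%E); last by rewrite normrN1 invr1.
rewrite -(ge0_integral_affine c)//.
by apply: eq_integral => x _; rewrite mulN1r addrC.
Qed.

End affine.

(** * Correlation functions *)

Definition distinct_pairs (R : realType) (A : set R) : set (R * R) :=
  (A `*` A) `&` [set p | p.1 != p.2].

Section tuples.
Context {R : realType}.
Local Notation mu := (@lebesgue_measure R).

Lemma integral_tuple1 (F : 1.-tuple R -> \bar R) :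
  integral_tuple F = (\int[mu]_x F [tuple x])%E.
Proof. by apply: eq_integral => x _; congr F; exact/val_inj. Qed.

Lemma integral_tuple2 (F : 2.-tuple R -> \bar R) :
  integral_tuple F = (\int[mu]_x \int[mu]_y F [tuple x; y])%E.
Proof.
apply: eq_integral => x _.
rewrite -[LHS]/(integral_tuple (fun t : 1.-tuple R => F [tuple of x :: t])) integral_tuple1.
by apply: eq_integral => y _; congr F; exact/val_inj.
Qed.

Lemma esum_distinct_tuples1 (A : set R) (f : R -> \bar R) :
  (\esum_(t in @distinct_tuples R 1 A) f (thead t) = \esum_(x in A) f x)%E.
Proof.
apply/esym/reindex_esum; split.
- by move=> t [_ /(_ ord0)].
- move=> s t _ _; case/tupleP: s => x s; case/tupleP: t => y t.
  by rewrite !theadE => ->; rewrite (tuple0 s) (tuple0 t).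
- move=> x Ax; exists [tuple x] => //=; split => // i.
  by rewrite (ord1 i).
Qed.

Lemma esum_distinct_tuples2 (A : set R) (f : R * R -> \bar R) :
  (\esum_(t in @distinct_tuples R 2 A) f (tnth t ord0, tnth t ord_max) =
   \esum_(p in distinct_pairs A) f p)%E.
Proof.
rewrite (@reindex_esum _ _ _ (@distinct_tuples R 2 A) _
  (fun t => (tnth t ord0, tnth t ord_max)))//; split.
- move=> t [ut At]; split; first by split; exact: At.
  move: ut; case/tupleP: t {At} => x t; case/tupleP: t => y t.
  by rewrite (tuple0 t)/= inE andbT /tnth/=.
- move=> s t _ _; case/tupleP: s => x s; case/tupleP: t => y t.
  case/tupleP: s => x' s; case/tupleP: t => y' t.
  rewrite /tnth/= => -[-> ->]; rewrite (tuple0 s) (tuple0 t).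
  exact: val_inj.
- move=> [x y] [[Ax Ay] xy]; exists [tuple x; y] => //=; split.
    by rewrite /= inE andbT.
  by case=> -[|[|//]] i2.
Qed.

Lemma esum_distinct_pairs_swap (A : set R) (f : R * R -> \bar R) :
  (\esum_(p in distinct_pairs A) f p = \esum_(p in distinct_pairs A) f (p.2, p.1))%E.
Proof.
rewrite (@reindex_esum _ _ _ (distinct_pairs A) _ (fun p : R * R => (p.2, p.1)))//.
split.
- by move=> [x y] [[/= Ax Ay] xy]; split => //=; rewrite eq_sym.
- by move=> [x y] [x' y'] _ _ /= [-> ->].
- by move=> [x y] [[/= Ax Ay] xy]; exists (y, x) => //=; split => //=; rewrite eq_sym.
Qed.

End tuples.

Section correlation.
Context {R : realType} {d : measure_display} {T : measurableType d}.
Context {P : probability T R} {X : T -> config R}.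
Local Notation mu := (@lebesgue_measure R).

Section one_point.
Context {rho : 1.-tuple R -> R}.
Context (corr : correlation_function P X rho).

Lemma integral_esum1 (f : R -> \bar R) :
  measurable_fun [set: R] f -> (forall x, 0 <= f x)%E ->
  (\int[P]_w (\esum_(x in X w) f x) = \int[mu]_x (f x * (rho [tuple x])%:E))%E.
Proof.
move=> mf f0; case: corr => _ _ /(_ (f \o (fun t => thead t))).
rewrite integral_tuple1 => <-.
- by apply: eq_integral => w _; rewrite esum_distinct_tuples1.
- by apply: measurableT_comp => //; exact: measurable_tnth.
- by move=> t; exact: f0.
Qed.

End one_point.

Context {rho : 2.-tuple R -> R} {r : R -> R}.
Context (corr : correlation_function P X rho).
Context (rhoE : forall x y, rho [tuple x; y] = r (x - y)).

Lemma pair_density_ge0 v : 0 <= r v.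
Proof. by case: corr => _ + _; rewrite -(subr0 v) -rhoE; exact. Qed.

(** Inherited from [rho] by restriction to the line of pairs (v, 0); this is the source of the
    measurability of [T2]. *)
Lemma measurable_pair_density : measurable_fun [set: R] r.
Proof.
rewrite (_ : r = rho \o (fun v => [tuple v; 0])); last first.
  by apply/funext => v /=; rewrite rhoE subr0.
case: corr => mrho _ _; apply: measurableT_comp => //.
by apply: measurable_cons => //; apply: measurable_cons.
Qed.

Lemma integral_esum2 (f : R * R -> \bar R) :
  measurable_fun [set: R * R] f -> (forall p, 0 <= f p)%E ->
  (\int[P]_w (\esum_(p in distinct_pairs (X w)) f p) =
   \int[mu]_x \int[mu]_y (f (x, y) * (r (x - y))%:E))%E.
Proof.
move=> mf f0.
case: corr => _ _ /(_ (fun t => f (tnth t ord0, tnth t ord_max))).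
rewrite integral_tuple2 => H.
transitivity (\int[mu]_x \int[mu]_y (f (x, y) * (rho [tuple x; y])%:E))%E; last first.
  by apply: eq_integral => x _; apply: eq_integral => y _; rewrite rhoE.
rewrite -[RHS]H.
- by apply: eq_integral => w _; rewrite esum_distinct_tuples2.
- by apply: measurableT_comp => //; apply/measurable_fun_pair; exact: measurable_tnth.
- by move=> t; exact: f0.
Qed.

(* Both sides are the expectation of the same sum over ordered pairs, read in
   the two orders. *)
Lemma pair_density_sym (h : R -> \bar R) :
  measurable_fun [set: R] h -> (forall v, 0 <= h v)%E ->
  (\int[mu]_v (h v * (r v)%:E) = \int[mu]_v (h v * (r (- v))%:E))%E.
Proof.
move=> mh h0.
have mr := measurable_pair_density.
have mB : measurable_fun [set: R * R] (fun p : R * R => p.1 - p.2).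
  by apply: measurable_funB.
(* The density depends on x - y only, so an unweighted sum over pairs would integrate to infinity.
   Weighting one coordinate by the indicator of [0, 1] makes the double integral factor: the inner
   integral does not depend on the outer variable, and the outer one is 1. *)
pose one x : \bar R := (\1_(`[0, 1]%classic : set R) x)%:E.
have mone : measurable_fun [set: R] one.
  by apply/measurable_EFinP; exact: measurable_indic.
have one0 x : (0 <= one x)%E by rewrite lee_fin.
have int1 : (\int[mu]_x one x = 1)%E.
  rewrite integral_indic// setIT /= lebesgue_measure_itv/= lte_fin ltr01.
  by rewrite oppr0 adde0.
pose f (p : R * R) := (one p.1 * h (p.1 - p.2)%R)%E.
have mf : measurable_fun [set: R * R] f.
  apply: emeasurable_funM; first exact: measurableT_comp.
  exact: measurableT_comp.
have f0 p : (0 <= f p)%E by rewrite mule_ge0.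
have mhr : measurable_fun [set: R] (fun v => h v * (r v)%:E)%E.
  by apply: emeasurable_funM => //; exact/measurable_EFinP.
have hr0 v : (0 <= h v * (r v)%:E)%E by rewrite mule_ge0 ?lee_fin ?pair_density_ge0.
have mhrN : measurable_fun [set: R] (fun v => h v * (r (- v))%:E)%E.
  by apply: emeasurable_funM => //; apply/measurable_EFinP/measurableT_comp.
have hrN0 v : (0 <= h v * (r (- v))%:E)%E by rewrite mule_ge0 ?lee_fin ?pair_density_ge0.
have mswap : measurable_fun [set: R * R] (fun p : R * R => (p.2, p.1)).
  exact: measurable_fun_pair.
have E1 : (\int[P]_w (\esum_(p in distinct_pairs (X w)) f p) =
    \int[mu]_v (h v * (r v)%:E))%E.
  rewrite integral_esum2// /f/=.
  transitivity (\int[mu]_x (one x * \int[mu]_v (h v * (r v)%:E)))%E.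
    apply: eq_integral => x _.
    under eq_integral do rewrite -muleA.
    rewrite ge0_integralZl//; last first.
    - have mxB : measurable_fun [set: R] (fun y : R => x - y) by exact: measurable_funB.
      exact: (measurableT_comp mhr mxB).
    by congr (_ * _)%E; rewrite -(ge0_integral_reflect x mhr hr0).
  rewrite ge0_integralZr// ?int1 ?mul1e//.
  by apply: integral_ge0 => v _; exact: hr0.
have E2 : (\int[P]_w (\esum_(p in distinct_pairs (X w)) f p) =
    \int[mu]_v (h v * (r (- v))%:E))%E.
  under eq_integral do rewrite esum_distinct_pairs_swap.
  rewrite (@integral_esum2 (fun p => f (p.2, p.1)))//; last first.
    exact: (measurableT_comp mf mswap).
  rewrite (@fubini_tonelli _ _ _ _ _ mu mu
    (fun p => (f (p.2, p.1) * (r (p.1 - p.2))%:E)%E)); last 2 first.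
  - apply: emeasurable_funM.
      exact: (measurableT_comp mf mswap).
    by apply/measurable_EFinP; exact: measurableT_comp.
  - by move=> p; rewrite mule_ge0 ?lee_fin ?pair_density_ge0.
  transitivity (\int[mu]_x (one x * \int[mu]_v (h v * (r (- v))%:E)))%E.
    apply: eq_integral => y _; rewrite /f/=.
    under eq_integral do rewrite -muleA -(opprB y).
    rewrite ge0_integralZl//; last first.
    - have mxB : measurable_fun [set: R] (fun x : R => y - x) by exact: measurable_funB.
      exact: (measurableT_comp mhrN mxB).
    by congr (_ * _)%E; rewrite -(ge0_integral_reflect y mhrN hrN0).
  rewrite ge0_integralZr// ?int1 ?mul1e//.
  by apply: integral_ge0 => v _; exact: hrN0.
by rewrite -E1 E2.
Qed.

End correlation.

(** * Expected pair sums over a window [0, a], with nonnegative even weights *)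

Section second_moment.
Context {R : realType} {d : measure_display} {T : measurableType d}.
Context {P : probability T R} {X : T -> config R}.
Context {rho : 2.-tuple R -> R} {r : R -> R}.
Context (corr : correlation_function P X rho).
Context (rhoE : forall x y, rho [tuple x; y] = r (x - y)).
Local Notation mu := (@lebesgue_measure R).

Let r_ge0 := pair_density_ge0 corr rhoE.
Let mr := measurable_pair_density corr rhoE.

(** The left interval omits 0 so that it is disjoint from the right one when an interval around 0 is
    cut there. *)
Lemma integral_pair_density_sym (g : R -> R) (a : R) :
  measurable_fun [set: R] g -> (forall v, 0 <= g v) -> (forall v, g (- v) = g v) ->
  (\int[mu]_(v in `[(- a)%R, 0%R[) (g v * r v)%:E =
   \int[mu]_(v in `[0%R, a]) (g v * r v)%:E)%E.
Proof.
move=> mg g0 gN; have mgr : measurable_fun [set: R] (fun v => (g v * r v)%:E).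
  by apply/measurable_EFinP; exact: measurable_funM.
rewrite -[RHS]integral_itv_obnd_cbnd; last exact: measurable_funTS.
pose h v : \bar R := ((g \_ `[- a, 0[) v)%:E.
have mh : measurable_fun [set: R] h.
  apply/measurable_EFinP; have /measurable_restrictT <- // : measurable [set` `[(- a)%R, 0%R[].
    by [].
  exact: measurable_funTS.
have h0 v : (0 <= h v)%E.
  by rewrite lee_fin /patch; case: ifPn.
transitivity (\int[mu]_v (h v * (r v)%:E))%E.
  rewrite integral_mkcond; apply: eq_integral => v _.
  by rewrite /h /patch; case: ifPn => _; rewrite ?EFinM ?mul0e.
rewrite (pair_density_sym corr rhoE mh h0).
have mk : measurable_fun [set: R] (fun v => h v * (r (- v))%:E)%E.
  by apply: emeasurable_funM => //; apply/measurable_EFinP/measurableT_comp.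
rewrite -(ge0_integral_reflect 0 mk); last first.
  by move=> v; rewrite mule_ge0 ?h0 ?lee_fin ?r_ge0.
rewrite [RHS]integral_mkcond; apply: eq_integral => v _.
rewrite sub0r opprK /h /patch !mem_setE !in_itv/= lerN2 oppr_lt0 andbC.
by case: ifPn => _; rewrite ?mul0e// gN EFinM.
Qed.

(** For fixed x the difference v = x - y runs over [[x - a, x]]. Cutting at 0 and folding the
    negative half by symmetry leaves two integrals that start at 0. *)
Lemma integral_esum_pairs (g : R -> R) (a : R) :
  measurable_fun [set: R] g -> (forall v, 0 <= g v) -> (forall v, g (- v) = g v) ->
  (\int[P]_w (\esum_(p in distinct_pairs (X w `&` `[0%R, a])) (g (p.1 - p.2))%:E) =
   \int[mu]_(x in `[0%R, a]) (\int[mu]_(v in `[0%R, x]) (g v * r v)%:E +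
                            \int[mu]_(v in `[0%R, (a - x)%R]) (g v * r v)%:E))%E.
Proof.
move=> mg g0 gN; have mgr : measurable_fun [set: R] (fun v => (g v * r v)%:E).
  by apply/measurable_EFinP; exact: measurable_funM.
have gr0 v : (0 <= (g v * r v)%:E)%E by rewrite lee_fin mulr_ge0 ?r_ge0.
pose f (p : R * R) : \bar R :=
  ((\1_(`[0%R, a]%classic : set R) p.1 * \1_(`[0%R, a]%classic : set R) p.2) * g (p.1 - p.2))%:E.
have mf : measurable_fun [set: R * R] f.
  apply/measurable_EFinP/measurable_funM.
    apply: measurable_funM; apply: measurableT_comp => //; exact: measurable_indic.
  by apply: measurableT_comp => //; exact: measurable_funB.
have f0 p : (0 <= f p)%E by rewrite lee_fin !mulr_ge0.
transitivity (\int[P]_w (\esum_(p in distinct_pairs (X w)) f p))%E.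
  apply: eq_integral => w _.
  rewrite (_ : distinct_pairs (X w `&` `[0, a]) = distinct_pairs (X w) `&`
      (`[0, a]%classic `*` `[0, a]%classic)); last first.
    by apply/seteqP; split=> -[x y] /=; rewrite /distinct_pairs/=; tauto.
  rewrite esum_mkcondr; apply: eq_esum => -[x y] _; rewrite in_setX /f/= !indicE.
  by case: (x \in _); case: (y \in _); rewrite ?mul1r ?mul0r.
rewrite (integral_esum2 corr rhoE)// [RHS]integral_mkcond.
apply: eq_integral => x _; rewrite /patch /f/= indicE.
case: ifPn => xa; last by rewrite integral0_eq// => y _; rewrite !mul0r mul0e.
move: xa; rewrite mem_setE in_itv/= => /andP[x0 xa].
pose k v : \bar R := (((fun v => (g v * r v)%:E) \_ `[x - a, x]) v).
have mk : measurable_fun [set: R] k.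
  have /measurable_restrictT <- // : measurable [set` `[(x - a)%R, x]] by [].
  exact: measurable_funTS.
have k0 v : (0 <= k v)%E by rewrite /k /patch; case: ifPn.
transitivity (\int[mu]_y k (x - y)%R)%E.
  apply: eq_integral => y _.
  rewrite /k /patch indicE !mem_setE !in_itv/= lerD2l lerN2 gerBl andbC.
  by case: ifPn => _; rewrite ?mul1r ?mul0r ?mul0e// subKr.
rewrite ge0_integral_reflect// /k -integral_mkcond.
rewrite (_ : `[x - a, x]%classic = `[x - a, 0[%classic `|` `[0, x]%classic); last first.
  by rewrite -itv_bndbnd_setU// bnd_simp// subr_le0.
rewrite ge0_integral_setU//=; last 2 first.
- exact: measurable_funTS.
- rewrite disj_set2E; apply/disj_setPS => v /= []; rewrite !in_itv/=.
  by move=> /andP[_ +] /andP[+ _]; rewrite leNgt => ->.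
by rewrite addeC -[X in `[X, 0[](opprB a x) integral_pair_density_sym.
Qed.

End second_moment.

(** * Measurability of pair sums *)

Section pair_sum.
Context {R : realType} {d : measure_display} {T : measurableType d}.
Context {X : T -> config R}.
Context (processX : simple_point_process X).

Local Notation enumS A := (finmap.enum_fset (fset_set A)).

Lemma finite_window (w : T) (a b : R) : finite_set (X w `&` `[a, b]).
Proof. by case: processX. Qed.

Lemma sum1_fset_set (I : choiceType) (A : set I) : finite_set A ->
  \sum_(x \in A) (1 : R) = (size (finmap.enum_fset (fset_set A)))%:R.
Proof. by move=> fA; rewrite fsbig_finite// big_const_seq count_predT iter_addr_0. Qed.

(** The generating events fix one value of the count. As the count is a natural number, the preimage
    of any Borel set is a countable union of them. *)
Lemma measurable_count (a b : R) (B : set R) : measurable B -> B `<=` `[a, b] ->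
  measurable_fun [set: T] (fun w => \sum_(x \in X w `&` B) (1 : R)).
Proof.
move=> mB sB; have fX w : finite_set (X w `&` B).
  by apply: sub_finite_set (finite_window w a b); exact: setIS.
move=> _ Y mY; rewrite setTI.
pose E n := X @^-1` [set A | counting (A `&` B) = (n%:R : R)%:E].
rewrite (_ : _ @^-1` _ = \bigcup_(n in [set n : nat | Y n%:R]) E n).
  apply: bigcup_measurable => n _.
  case: processX => _ mX; rewrite -[E n]setTI; apply: mX => //.
  by apply: sub_sigma_algebra; exists B => //; exists n.
apply/seteqP; split=> w /=.
- rewrite sum1_fset_set// => Yw; exists (size (finmap.enum_fset (fset_set (X w `&` B)))) => //.
  by rewrite /E /= /counting; case: asboolP.
- move=> [n /= Yn]; rewrite /E /= /counting; case: asboolP => // _ [En].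
  by rewrite sum1_fset_set// En.
Qed.

Lemma distinct_pairs_sum (g : R -> R) (A : set R) : finite_set A ->
  \sum_(p \in distinct_pairs A) g (p.1 - p.2) =
  \sum_(x <- enumS A) \sum_(y <- enumS A) (if x != y then g (x - y) else 0).
Proof.
move=> fA; rewrite fsbig_mkcondr.
transitivity (\sum_(p \in A `*` A) (fun x y => if x != y then g (x - y) else 0) p.1 p.2).
  by apply: eq_fsbigr => -[x y] _ /=; rewrite mem_setE.
rewrite -(@pair_fsbig R 0 _ _ _ A A (fun x y => if x != y then g (x - y) else 0) fA fA).
by rewrite fsbig_finite//; apply: eq_bigr => x _; rewrite fsbig_finite.
Qed.

(* Replace each point by the left end of its cell in a grid of mesh a / n.+1;
   the grid points 0 and a are fixed, which takes care of the pair (0, a). *)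
Lemma measurable_pair_sum (g : R -> R) (a : R) : 0 < a ->
  (forall v, 0 < `|v| < a -> {for v, continuous g}) ->
  measurable_fun [set: T]
    (fun w => \sum_(p \in distinct_pairs (X w `&` `[0, a])) g (p.1 - p.2)).
Proof.
move=> a0 cg.
pose idx n (x : R) := Num.truncn (x * n.+1%:R / a).
pose c n (i : nat) : R := i%:R * a / n.+1%:R.
pose B n i := `[0, a]%classic `&` [set x | idx n x = i].
pose N n i w := \sum_(x \in X w `&` B n i) (1 : R).
have idxE n i x : 0 <= x -> (idx n x == i) = (c n i <= x < c n i.+1).
  move=> x0; rewrite truncn_eq; last by rewrite divr_ge0 ?mulr_ge0// ltW.
  by rewrite ler_pdivlMr// ltr_pdivrMr// /c ler_pdivrMr// ltr_pdivlMr.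
have cell n x : 0 <= x -> c n (idx n x) <= x < c n (idx n x) + a / n.+1%:R.
  move=> x0; rewrite (_ : c n (idx n x) + _ = c n (idx n x).+1) -?idxE ?eqxx//.
  by rewrite /c -[(idx n x).+1%:R]natr1 !mulrDl mul1r.
have mB n i : measurable (B n i).
  rewrite (_ : B n i = `[0, a]%classic `&` `[c n i, c n i.+1[%classic); first exact: measurableI.
  apply/seteqP; split=> x; rewrite /B/= !in_itv/= => -[/andP[x0 xa]].
    by move/eqP; rewrite idxE// x0 xa.
  by rewrite -idxE// => /eqP; rewrite x0 xa.
pose G n (i j : nat) := if i != j then g (c n i - c n j) else 0.
(* A polynomial in the counts, hence measurable. Pairs in a common cell are dropped by [G]. There
   are [n.+2] cells because x = a has index [n.+1]. *)
pose S n w := \sum_(i < n.+2) (N n i w * \sum_(j < n.+2) (N n j w * G n i j)).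
apply: (@measurable_fun_cvg _ _ _ _ S) => [n|w _].
  have mN i : measurable_fun [set: T] (N n i).
    by apply: (@measurable_count 0 a) => // x [].
  apply: measurable_sum => i; apply: measurable_funM => //.
  apply: measurable_sum => j; apply: measurable_funM => //; exact: measurable_cst.
pose A := X w `&` `[0, a]; have fA : finite_set A by exact: finite_window.
have As x : x \in enumS A -> 0 <= x <= a.
  by rewrite in_fset_set// inE => -[_]; rewrite /= in_itv/=.
rewrite distinct_pairs_sum//.
have sumN n (F : nat -> R) :
    \sum_(i < n.+2) (N n i w * F i) = \sum_(x <- enumS A) F (idx n x).
  transitivity (\sum_(i < n.+2) \sum_(x <- enumS A) ((idx n x == i)%:R * F i)).
    apply: eq_bigr => i _; rewrite -mulr_suml; congr (_ * _).
    rewrite /N /B setIA -/A fsbig_mkcondr fsbig_finite//; apply: eq_bigr => x _.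
    by case: (eqVneq (idx n x) i) => H; [rewrite mem_set|rewrite memNset//; exact/eqP].
  rewrite exchange_big/= big_seq [RHS]big_seq; apply: eq_bigr => x /As/andP[x0 xa].
  have idxn : (idx n x < n.+2)%N.
    rewrite ltnS -(ler_nat R) -(ler_pM2r a0) -ler_pdivrMl// mulrC.
    by rewrite (le_trans _ xa)//; case/andP: (cell n x x0).
  rewrite (bigD1 (Ordinal idxn))//= eqxx mul1r big1 ?addr0// => i.
  by rewrite eq_sym -val_eqE /= => /negbTE ->; rewrite mul0r.
have SE n : S n w = \sum_(x <- enumS A) \sum_(y <- enumS A) G n (idx n x) (idx n y).
  rewrite /S; under eq_bigr do rewrite sumN.
  by rewrite (sumN n (fun i => \sum_(y <- enumS A) G n i (idx n y))).
rewrite (eq_cvg _ _ SE).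
have mesh : a / n.+1%:R @[n --> \oo] --> 0.
  by rewrite -(mulr0 a); apply: cvgM; [exact: cvg_cst|exact: cvg_harmonic].
have cvgc x : 0 <= x <= a -> c n (idx n x) @[n --> \oo] --> x.
  move=> xa; apply: (@squeeze_cvgr _ _ _ _ (fun n => x - a / n.+1%:R) (fun=> x)).
  - near=> n; case/andP: xa => x0 _; have /andP[-> /ltW] := cell n x x0.
    by rewrite lerBlDr => ->.
  - by rewrite -[X in _ --> X]subr0; apply: cvgB => //; exact: cvg_cst.
  - exact: cvg_cst.
have cvgG x y : 0 <= x <= a -> 0 <= y <= a ->
    G n (idx n x) (idx n y) @[n --> \oo] --> (if x != y then g (x - y) else 0).
  move=> xa ya; case: (eqVneq x y) => [->|xy]/=.
    by apply: cvg_near_cst; apply: nearW => n; rewrite /G eqxx.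
  (* Once the mesh is below |x - y|, the two points lie in different cells. *)
  have Gxy : \forall n \near \oo,
      g (c n (idx n x) - c n (idx n y)) = G n (idx n x) (idx n y).
    near=> n; rewrite /G ifT//; apply/eqP => eidx.
    have : a / n.+1%:R < `|x - y|.
      by near: n; apply: (cvgr_lt _ mesh); rewrite normr_gt0 subr_eq0.
    apply/negP; rewrite -leNgt ler_norml.
    case/andP: xa => /(cell n)/andP[+ +] _; case/andP: ya => /(cell n)/andP[+ +] _.
    by rewrite eidx; move: (a / _) (c _ _) => e z *; apply/andP; split; lra.
  apply: cvg_trans; first exact: (near_eq_cvg Gxy).
  have [xya|xya] := ltP `|x - y| a.
    apply: (continuous_cvg _ (cg _ _)); first by rewrite xya normr_gt0 subr_eq0 xy.
    by apply: cvgB; exact: cvgc.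
  (* At distance a, where [g] may be discontinuous, the points are 0 and a; both are their own grid
     points, so the approximation is exact for every n. *)
  have cE x' n : x' = 0 \/ x' = a -> c n (idx n x') = x'.
    rewrite /c /idx => -[->|->]; first by rewrite !mul0r truncn0 !mul0r.
    have -> : a * n.+1%:R / a = n.+1%:R by rewrite mulrC mulKf ?gt_eqF.
    by rewrite natrK mulrC mulKf// pnatr_eq0.
  have [x'a y'a] : (x = 0 \/ x = a) /\ (y = 0 \/ y = a).
    move: xya xa ya; rewrite ler_normr => /orP[] ? /andP[? ?] /andP[? ?]; split.
    - by right; lra.
    - by left; lra.
    - by left; lra.
    - by right; lra.
  by apply: cvg_near_cst; apply: nearW => n; rewrite !cE.
have cvgs (u : R -> nat -> R) (l : R -> R) :
    (forall x, 0 <= x <= a -> u x n @[n --> \oo] --> l x) ->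
    \sum_(x <- enumS A) u x n @[n --> \oo] --> \sum_(x <- enumS A) l x.
  move=> ul; rewrite big_seq (eq_cvg _ _ (fun n => big_seq _ _ _ _)).
  by apply: cvg_big => [|x /As/ul//]; exact: add_continuous.
apply: (cvgs (fun x n => \sum_(y <- enumS A) G n (idx n x) (idx n y))) => x xa.
by apply: (cvgs (fun y n => G n (idx n x) (idx n y))) => y ya; exact: cvgG.
Unshelve. all: by end_near. Qed.

End pair_sum.

(** * Integrals over intervals *)

Section intervals.
Context {R : realType}.
Local Notation mu := (@lebesgue_measure R).

Lemma reflect_itv (c u v : R) :
  (fun x => -1 * x + c) @^-1` `[u, v] = `[c - v, c - u]%classic.
Proof.
by apply/seteqP; split=> x/=; rewrite !in_itv/= => /andP[? ?]; apply/andP; split; lra.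
Qed.

Lemma integrable_reflect (c u v : R) (f : R -> R) :
  mu.-integrable `[u, v] (EFin \o f) ->
  mu.-integrable `[c - v, c - u] (EFin \o (fun x => f (c - x))).
Proof.
move=> fi; rewrite -reflect_itv.
rewrite (_ : EFin \o _ = fun x => (EFin \o f) (-1 * x + c)).
  by apply: integrable_affine => //; rewrite oppr_eq0 oner_eq0.
by apply/funext => x /=; rewrite mulN1r addrC.
Qed.

Lemma Rintegral_reflect (c u v : R) (f : R -> R) :
  mu.-integrable `[u, v] (EFin \o f) ->
  \int[mu]_(x in `[c - v, c - u]) f (c - x) = \int[mu]_(x in `[u, v]) f x.
Proof.
move=> fi; rewrite -reflect_itv.
transitivity (\int[mu]_(x in (fun x => -1 * x + c) @^-1` `[u, v]) f (-1 * x + c)).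
  by apply: eq_Rintegral => x _; rewrite mulN1r addrC.
by rewrite Rintegral_affine// ?oppr_eq0 ?oner_eq0// normrN1 invr1 mul1r.
Qed.

Lemma integrable_subitv (u v u' v' : R) (f : R -> R) : u <= u' -> v' <= v ->
  mu.-integrable `[u, v] (EFin \o f) -> mu.-integrable `[u', v'] (EFin \o f).
Proof.
move=> uu vv; apply: integrableS => //.
by apply: subset_itv; rewrite bnd_simp.
Qed.

Lemma Rintegral_itv_split (u m v : R) (f : R -> R) : u <= m -> m <= v ->
  mu.-integrable `[u, v] (EFin \o f) ->
  \int[mu]_(x in `[u, v]) f x =
  \int[mu]_(x in `[u, m]) f x + \int[mu]_(x in `[m, v]) f x.
Proof.
move=> um mv fi; apply/eqP; rewrite addrC -subr_eq; apply/eqP.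
rewrite Rintegral_itvB ?bnd_simp// Rintegral_itv_obnd_cbnd//.
apply: integrableS fi => //; apply: subset_itv; rewrite bnd_simp//.
Qed.

Lemma integrable_itv_join (u m v : R) (f : R -> R) : u <= m -> m <= v ->
  mu.-integrable `[u, m] (EFin \o f) -> mu.-integrable `[m, v] (EFin \o f) ->
  mu.-integrable `[u, v] (EFin \o f).
Proof.
move=> um mv i1 i2.
have i3 : mu.-integrable `]m, v] (EFin \o f).
  by apply: integrableS i2 => //; apply: subset_itv; rewrite bnd_simp.
have /integrableP[m1 f1] := i1; have /integrableP[m3 f3] := i3.
rewrite (@itv_bndbnd_setU _ _ _ (BRight m)) ?bnd_simp//.
have mf : measurable_fun (`[u, m] `|` `]m, v]) (EFin \o f).
  exact/measurable_funU.
apply/integrableP; split => //.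
rewrite ge0_integral_setU//; first exact: lte_add_pinfty.
  exact: measurableT_comp.
rewrite disj_set2E; apply/disj_setPS => x [] /=; rewrite !in_itv/=.
by move=> /andP[_ +] /andP[+ _]; rewrite leNgt => /negbTE ->.
Qed.

Lemma integrable_cst_itv (u v k : R) :
  mu.-integrable `[u, v] (EFin \o (fun=> k)).
Proof.
apply: continuous_compact_integrable; first exact: segment_compact.
by apply: continuous_subspaceT => x; exact: cvg_cst.
Qed.

Lemma integrable_primitive (a : R) (f : R -> R) : 0 <= a ->
  mu.-integrable `[0, a] (EFin \o f) ->
  mu.-integrable `[0, a] (EFin \o (fun x => \int[mu]_(v in `[0, x]) f v)).
Proof.
move=> a0 fi; apply: continuous_compact_integrable; first exact: segment_compact.
exact: parameterized_integral_continuous.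
Qed.

Lemma norm_Rintegral_le (D : set R) (f g : R -> R) : measurable D ->
  mu.-integrable D (EFin \o f) -> mu.-integrable D (EFin \o g) ->
  (forall x, D x -> `|f x| <= g x) ->
  `|\int[mu]_(x in D) f x| <= \int[mu]_(x in D) g x.
Proof.
move=> mD fi gi fg; apply: (le_trans (le_normr_Rintegral _ fi)) => //.
by apply: le_Rintegral => //; exact: integrable_norm.
Qed.

Lemma integrable_bounded_mul (D : set R) (f g : R -> R) (M : R) : measurable D ->
  measurable_fun D g -> (forall x, D x -> `|g x| <= M) ->
  mu.-integrable D (EFin \o f) -> mu.-integrable D (EFin \o (fun x => g x * f x)).
Proof.
move=> mD mg gM fi.
have mf : measurable_fun D f by case/integrableP: fi => /measurable_EFinP.
apply: (@le_integrable _ _ _ mu _ _ _ (fun x => (M * f x)%:E)) => //.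
- by apply/measurable_EFinP; exact: measurable_funM.
- move=> x Dx; rewrite /= lee_fin !normrM ler_wpM2r//.
  by rewrite (le_trans (gM x Dx))// ler_norm.
- by rewrite (_ : (fun x => _) = (fun x => M%:E * (EFin \o f) x)%E)//; exact: integrableZl.
Qed.

Lemma integrable_bounded_itv (f : R -> R) (M u v : R) :
  measurable_fun [set: R] f -> (forall x, `|f x| <= M) ->
  mu.-integrable `[u, v] (EFin \o f).
Proof.
move=> mf fM; have fM' x : `[u, v]%classic x -> `|f x| <= M by [].
have := integrable_bounded_mul (measurable_itv _) (measurable_funTS mf) fM'
  (integrable_cst_itv u v 1).
by rewrite (_ : (fun x => f x * 1) = f)//; apply/funext => x; rewrite mulr1.
Qed.

End intervals.

(** * Expectations of pair sums *)

Section triangle_integral.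
Context {R : realType}.
Local Notation mu := (@lebesgue_measure R).

(* Equal to the integral of f (x - y) over the square [0, a]^2 when f is even. *)
Definition triangle_integral (f : R -> R) (a : R) : R :=
  \int[mu]_(x in `[0, a]) (\int[mu]_(v in `[0, x]) f v +
                           \int[mu]_(v in `[0, a - x]) f v).

Lemma integrable_primitive_rev (a : R) (f : R -> R) : 0 <= a ->
  mu.-integrable `[0, a] (EFin \o f) ->
  mu.-integrable `[0, a] (EFin \o (fun x => \int[mu]_(v in `[0, a - x]) f v)).
Proof.
move=> a0 fi; have := integrable_reflect a (integrable_primitive a0 fi).
by rewrite subrr subr0.
Qed.


Lemma integrable_triangle (a : R) (f : R -> R) : 0 <= a ->
  mu.-integrable `[0, a] (EFin \o f) ->
  mu.-integrable `[0, a] (EFin \o (fun x => \int[mu]_(v in `[0, x]) f v +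
                           \int[mu]_(v in `[0, a - x]) f v)).
Proof.
move=> a0 fi.
have := integrableD _ (integrable_primitive a0 fi) (integrable_primitive_rev a0 fi).
exact.
Qed.

Lemma triangle_integralB (f g : R -> R) (a : R) : 0 <= a ->
  mu.-integrable `[0, a] (EFin \o f) -> mu.-integrable `[0, a] (EFin \o g) ->
  triangle_integral (fun v => f v - g v) a =
  triangle_integral f a - triangle_integral g a.
Proof.
move=> a0 fi gi; rewrite /triangle_integral -RintegralB//; try exact: integrable_triangle.
apply: eq_Rintegral => x; rewrite inE/= in_itv/= => /andP[x0 xa].
rewrite !RintegralB//; last 4 first.
- by apply: integrable_subitv fi => //; lra.
- by apply: integrable_subitv gi => //; lra.
- by apply: integrable_subitv fi => //; lra.
- by apply: integrable_subitv gi => //; lra.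
lra.
Qed.

End triangle_integral.

Section pair_expectation.
Context {R : realType} {d : measure_display} {T : measurableType d}.
Context {P : probability T R} {X : T -> config R}.
Context {rho : 2.-tuple R -> R} {r : R -> R}.
Context (processX : simple_point_process X).
Context (corr : correlation_function P X rho).
Context (rhoE : forall x y, rho [tuple x; y] = r (x - y)).
Local Notation mu := (@lebesgue_measure R).

Definition pair_sum (g : R -> R) (a : R) (w : T) : R :=
  \sum_(p \in distinct_pairs (X w `&` `[0, a])) g (p.1 - p.2).

Lemma ge0_pair_sum_expectation (g : R -> R) (a : R) : 0 < a ->
  measurable_fun [set: R] g -> (forall v, 0 <= g v) -> (forall v, g (- v) = g v) ->
  (forall v, 0 < `|v| < a -> {for v, continuous g}) ->
  mu.-integrable `[0, a] (EFin \o (fun v => g v * r v)) ->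
  P.-integrable [set: T] (EFin \o pair_sum g a) /\
  (\int[P]_w (pair_sum g a w)%:E = (triangle_integral (fun v => g v * r v) a)%:E)%E.
Proof.
move=> a0 mg g0 gN cg gri.
have S0 w : 0 <= pair_sum g a w.
  rewrite /pair_sum distinct_pairs_sum; last exact: finite_window.
  by rewrite !sumr_ge0// => x _; rewrite sumr_ge0// => y _; case: ifP.
have E : (\int[P]_w (pair_sum g a w)%:E = (triangle_integral (fun v => g v * r v) a)%:E)%E.
  transitivity (\int[P]_w 
    (\esum_(p in distinct_pairs (X w `&` `[0%R, a])) (g (p.1 - p.2))%:E))%E.
    apply: eq_integral => w _; have fA := finite_window processX w 0 a.
    have fp : finite_set (distinct_pairs (X w `&` `[0, a])).
      by apply: finite_setIl; exact: finite_setX.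
    rewrite esum_fset//.
      by rewrite fsumEFin.
    by move=> p _; rewrite lee_fin.
  rewrite (integral_esum_pairs corr rhoE)//.
  rewrite /triangle_integral [in RHS]/Rintegral fineK.
    apply: eq_integral => x; rewrite inE/= in_itv/= => /andP[x0 xa].
    rewrite EFinD !fineK//; apply: integrable_fin_num => //.
      by apply: integrable_subitv gri => //; lra.
    by apply: integrable_subitv gri => //; lra.
  apply: integrable_fin_num => //.
  exact: integrable_triangle (ltW a0) gri.
split => //; apply/integrableP; split.
  by apply/measurable_EFinP; exact: measurable_pair_sum.
under eq_integral do rewrite /= ger0_norm//.
by rewrite E ltry.
Qed.

(** Both C and C - g are nonnegative, so the previous lemma applies to each, and g is their
    difference. An upper bound on g is enough, which suits a logarithmic singularity at 0. *)
Lemma pair_sum_expectation (g : R -> R) (C a : R) : 0 < a -> 0 <= C ->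
  measurable_fun [set: R] g -> (forall v, g v <= C) -> (forall v, g (- v) = g v) ->
  (forall v, 0 < `|v| < a -> {for v, continuous g}) ->
  mu.-integrable `[0, a] (EFin \o r) ->
  mu.-integrable `[0, a] (EFin \o (fun v => g v * r v)) ->
  P.-integrable [set: T] (EFin \o pair_sum g a) /\
  (\int[P]_w (pair_sum g a w)%:E = (triangle_integral (fun v => g v * r v) a)%:E)%E.
Proof.
move=> a0 C0 mg gC gN cg ri gri.
have cri : mu.-integrable `[0, a] (EFin \o (fun v => C * r v)).
  by have := @integrableZl _ _ _ mu `[0, a]%classic _ C _ ri; exact.
have dri : mu.-integrable `[0, a] (EFin \o (fun v => (C - g v) * r v)).
  rewrite (_ : (fun v => _) = (fun v => C * r v - g v * r v)); last first.
    by apply/funext => v; rewrite mulrBl.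
  by have := integrableB _ cri gri; exact.
have [cS cE] := @ge0_pair_sum_expectation (fun=> C) a a0 (measurable_cst _)
  (fun=> C0) (fun=> erefl) (fun _ _ => cvg_cst _) cri.
have [dS dE] : P.-integrable [set: T] (EFin \o pair_sum (fun v => C - g v) a) /\
    (\int[P]_w (pair_sum (fun v => C - g v) a w)%:E =
     (triangle_integral (fun v => (C - g v) * r v) a)%:E)%E.
  apply: ge0_pair_sum_expectation => //.
  - exact: measurable_funB.
  - by move=> v; rewrite subr_ge0.
  - by move=> v; rewrite gN.
  - by move=> v va; apply: cvgB; [exact: cvg_cst|exact: cg].
have SE : pair_sum g a = (fun w => pair_sum (fun=> C) a w - pair_sum (fun v => C - g v) a w).
  apply/funext => w; have fA := finite_window processX w 0 a.
  rewrite /pair_sum distinct_pairs_sum// (distinct_pairs_sum (fun=> C))//.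
  rewrite (distinct_pairs_sum (fun v => C - g v))// -sumrB; apply: eq_bigr => x _.
  rewrite -sumrB; apply: eq_bigr => y _; case: ifP => _; lra.
rewrite SE; split; first by have := integrableB _ cS dS; exact.
transitivity (\int[P]_w ((pair_sum (fun=> C) a w)%:E - (pair_sum (fun v => C - g v) a w)%:E))%E.
  by [].
rewrite [LHS](integralB_EFin measurableT cS dS) cE dE -EFinB; congr EFin.
rewrite -(triangle_integralB (ltW a0) cri dri).
rewrite (_ : (fun v => C * r v - _) = (fun v => g v * r v))//.
by apply/funext => v; rewrite mulrBl opprB addrC subrK.
Qed.

End pair_expectation.

(** * The function log |2 sin(pi v / a)| *)

Section trigonometry.
Context {R : realType}.
Implicit Type x : R.

Lemma sin_mvt x : 0 <= x -> exists2 c, 0 <= c <= x & sin x = x * cos c.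
Proof.
move=> x0; have dsin y : y \in `]0, x[%R -> is_derive y 1 (@sin R) (cos y).
  by move=> _; exact: is_derive_sin.
have csin : {within `[0, x], continuous (@sin R)}.
  by apply: continuous_subspaceT => y; exact: continuous_sin.
have [c] := MVT_segment x0 dsin csin.
by rewrite in_itv/= sin0 !subr0 mulrC => cx sE; exists c.
Qed.

Lemma sin_le_id x : 0 <= x -> sin x <= x.
Proof. by move=> x0; have [c _ ->] := sin_mvt x0; rewrite ler_piMr// cos_le1. Qed.

(** From cos x = 1 - 2 sin(x / 2)^2 and sin(x / 2) <= x / 2. *)
Lemma cos_ge_quadratic x : 0 <= x <= pi -> 1 - x ^+ 2 / 2 <= cos x.
Proof.
move=> /andP[x0 xpi]; have -> : x = (x / 2) *+ 2 by field.
have h0 : 0 <= x / 2 by rewrite divr_ge0.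
have s0 : 0 <= sin (x / 2).
  by apply: sin_ge0_pi; rewrite h0/= (le_trans _ xpi)// ler_pdivrMr// ler_peMr// ler1n.
rewrite cos_mulr2n cos2sin2; have := sin_le_id h0; move: (sin _) s0 => s s0 sh.
have : s ^+ 2 <= (x / 2) ^+ 2 by rewrite ler_sqr ?nnegrE.
lra.
Qed.

Lemma sin_ge_mulcos x : 0 <= x <= pi -> x * cos x <= sin x.
Proof.
move=> /andP[x0 xpi]; have [c /andP[c0 cx] ->] := sin_mvt x0.
rewrite ler_wpM2l//; have := @ltr_cos R; rewrite /prop_in2 /=.
move=> H; rewrite leNgt H ?in_itv/= ?c0 ?x0 ?xpi -?leNgt// (le_trans cx)//.
Qed.

(** With h = x / 2, sin x = 2 sin h cos h >= x (cos h)^2, and 2 (cos h)^2 = 1 + cos x >= 1. *)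
Lemma sin_ge_half x : 0 <= x <= pi / 2 -> x / 2 <= sin x.
Proof.
move=> /andP[x0 xp]; have p0 := pi_gt0 R.
have c0 : 0 <= cos x by apply: cos_ge0_pihalf; rewrite xp andbT; lra.
have h : 0 <= x / 2 <= pi by apply/andP; split; lra.
have hc0 : 0 <= cos (x / 2) by apply: cos_ge0_pihalf; apply/andP; split; lra.
have := sin_ge_mulcos h.
have xE : x = (x / 2) *+ 2 by field.
have cE : cos x = cos (x / 2) ^+ 2 *+ 2 - 1 by rewrite {1}xE cos_mulr2n.
have sE : sin x = (cos (x / 2) * sin (x / 2)) *+ 2 by rewrite {1}xE sin_mulr2n.
rewrite sE; move: cE c0 hc0; move: (cos x) (cos _) (sin _) => C c s.
by move=> -> ? ? ?; nra.
Qed.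

End trigonometry.

Section log_integral.
Context {R : realType}.
Local Notation mu := (@lebesgue_measure R).

(** The primitive v - v ln v gives the value 1 - e + e ln e. The fundamental theorem needs
    continuity, hence the cut at e; monotone convergence removes it afterwards. *)
Lemma integral_nln_le (e : R) : 0 < e < 1 ->
  (\int[mu]_(v in `[e, 1%R]) (- ln v)%:E <= 1)%E.
Proof.
move=> /andP[e0 e1]; pose F (v : R) := v - v * ln v.
have dF (v : R) : 0 < v -> is_derive v (1 : R) F (- ln v).
  move=> v0; have := is_derive1_ln v0 => dln.
  by apply: is_derive_eq; rewrite /GRing.scale/= mulr1 mulfV ?gt_eqF//; lra.
have cF (v : R) : 0 < v -> {for v, continuous F}.
  by move=> v0; apply: differentiable_continuous; apply/derivable1_diffP; case: (dF v v0).
rewrite (@continuous_FTC2 _ _ F)//.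
- rewrite -EFinD lee_fin /F ln1 mulr0 subr0.
  have : ln e <= 0 by rewrite ln_le0// ltW.
  by move=> ?; nra.
- apply: continuous_in_subspaceT => v; rewrite inE/= in_itv/= => /andP[ev _].
  by apply: cvgN; apply: continuous_ln; exact: lt_le_trans ev.
- split.
  + by move=> v; rewrite in_itv/= => /andP[ev _]; case: (dF v (lt_trans e0 ev)).
  + by apply: cvg_at_right_filter; exact: cF.
  + by apply: cvg_at_left_filter; exact: cF.
- by move=> v; rewrite in_itv/= => /andP[ev _]; rewrite derive1E; case: (dF v (lt_trans e0 ev)).
Qed.

Lemma integral_ln01 : (\int[mu]_(v in `[0%R, 1%R]) (- ln v)%:E <= 1)%E.
Proof.
rewrite -integral_itv_obnd_cbnd; last first.
  by apply/measurable_EFinP; apply: measurable_funTS; exact: measurableT_comp.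
(* With [n.+2] the left end is strictly below 1 already for n = 0. *)
pose F n : set R := `[n.+2%:R^-1, 1%R]%classic.
rewrite (_ : `]0%R, 1%R]%classic = \bigcup_n F n); last first.
  apply/seteqP; split=> v /=; rewrite in_itv/=.
    move=> /andP[v0 v1]; exists (Num.truncn v^-1) => //.
    rewrite /F/= in_itv/= v1 andbT invf_ple ?posrE//.
    have vi : 0 <= v^-1 by rewrite invr_ge0 ltW.
    have /andP[_ /ltW/le_trans ->//] := truncn_itv vi.
    by rewrite ler_nat.
  move=> [n _]; rewrite /F/= in_itv/= => /andP[nv ->]; rewrite andbT.
  by apply: lt_le_trans nv; rewrite invr_gt0.
have cvgF : (\int[mu]_(v in F n) (- ln v)%:E @[n --> \oo] -->
    \int[mu]_(v in \bigcup_n F n) (- ln v)%:E)%E.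
  apply: ge0_nondecreasing_set_cvg_integral.
  - apply/nondecreasing_seqP => n; apply/subsetPset; apply: subset_itv; rewrite bnd_simp//.
    by rewrite lef_pV2 ?posrE// ler_nat.
  - by move=> n; exact: measurable_itv.
  - by move=> n; apply/measurable_EFinP; apply: measurable_funTS; exact: measurableT_comp.
  - move=> n v; rewrite /F/= in_itv/= => /andP[_ v1].
    by rewrite lee_fin oppr_ge0 ln_le0.
rewrite -(cvg_lim _ cvgF)//; apply: lime_le; first exact: cvgP cvgF.
apply: nearW => n; apply: integral_nln_le.
by rewrite invr_gt0 ltr0n invf_lt1 ?ltr1n.
Qed.

Lemma measurable_absln (D : set R) : measurable_fun D (fun v : R => `|ln v|).
Proof. by apply: measurable_funTS; exact: measurableT_comp. Qed.

Lemma integrable_ln01 : mu.-integrable `[0, 1] (EFin \o (fun v : R => `|ln v|)).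
Proof.
apply/integrableP; split; first by apply/measurable_EFinP; exact: measurable_absln.
apply: le_lt_trans (ltry 1); apply: le_trans _ integral_ln01.
rewrite le_eqVlt; apply/orP; left; apply/eqP; apply: eq_integral => v.
by rewrite inE/= in_itv/= => /andP[_ v1]; rewrite normr_id ler0_norm// ln_le0.
Qed.

Lemma integrable_ln1 (a : R) : mu.-integrable `[1, a] (EFin \o (fun v : R => `|ln v|)).
Proof.
apply: continuous_compact_integrable; first exact: segment_compact.
apply: continuous_in_subspaceT => v; rewrite inE/= in_itv/= => /andP[v1 _].
by apply: continuous_comp; [apply: continuous_ln; lra|exact: norm_continuous].
Qed.

Lemma integrable_absln (a : R) : mu.-integrable `[0, a] (EFin \o (fun v : R => `|ln v|)).
Proof.
have [a1|/ltW a1] := leP a 1.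
  by apply: integrable_subitv integrable_ln01.
apply: (integrable_itv_join _ a1) => //; first exact: integrable_ln01.
exact: integrable_ln1.
Qed.

Lemma Rintegral_absln (a : R) : 1 <= a ->
  \int[mu]_(v in `[0, a]) `|ln v| <= 1 + a * ln a.
Proof.
move=> a1; rewrite (Rintegral_itv_split (m := 1))//; last exact: integrable_absln.
apply: lerD.
  rewrite -lee_fin /Rintegral fineK; last first.
    by apply: integrable_fin_num => //; exact: integrable_ln01.
  apply: le_trans _ integral_ln01.
  rewrite le_eqVlt; apply/orP; left; apply/eqP; apply: eq_integral => v.
  by rewrite inE/= in_itv/= => /andP[_ v1]; rewrite ler0_norm// ln_le0.
apply: (@le_trans _ _ (\int[mu]_(v in `[1, a]) ln a)).
  apply: le_Rintegral => //; first exact: integrable_ln1.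
    exact: integrable_cst_itv.
  move=> v /=; rewrite in_itv/= => /andP[v1 va]; rewrite ger0_norm ?ln_ge0//.
  by rewrite ler_ln ?posrE//; lra.
rewrite Rintegral_cst//= lebesgue_measure_itv/= lte_fin.
have : 0 <= ln a by exact: ln_ge0.
by case: ifPn => _ /= ?; nra.
Qed.

End log_integral.

Section log_sine.
Context {R : realType}.
Local Notation mu := (@lebesgue_measure R).

Definition logsin (a v : R) : R := ln `|2 * sin (pi * v / a)|.

Lemma logsin_le (a v : R) : logsin a v <= ln 2.
Proof.
rewrite /logsin; have [->|s0] := eqVneq (sin (pi * v / a)) 0.
  by rewrite mulr0 normr0 ln0// ln_ge0// ler1n.
rewrite ler_ln ?posrE ?normr_gt0 ?mulf_neq0//.
by rewrite normrM ger0_norm// ler_piMr// sin_max.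
Qed.

Lemma logsinN (a v : R) : logsin a (- v) = logsin a v.
Proof. by rewrite /logsin mulrN mulNr sinN mulrN normrN. Qed.

Lemma logsin_reflect (a v : R) : 0 < a -> logsin a (a - v) = logsin a v.
Proof.
move=> a0; rewrite /logsin; congr (ln `|2 * _|).
have -> : pi * (a - v) / a = - (pi * v / a) + pi by field; rewrite gt_eqF.
by rewrite sinDpi sinN opprK.
Qed.

Lemma measurable_logsin (a : R) : measurable_fun [set: R] (logsin a).
Proof.
apply: measurableT_comp => //; apply: measurableT_comp => //.
apply: measurable_funM; first exact: measurable_cst.
apply: continuous_measurable_fun => v; apply: continuous_comp; last exact: continuous_sin.
by apply: cvgM; [apply: cvgM; [exact: cvg_cst|exact: cvg_id]|exact: cvg_cst].
Qed.

Lemma continuous_logsin (a v : R) : 0 < `|v| < a -> {for v, continuous (logsin a)}.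
Proof.
move=> /andP[v0 va]; have a0 : 0 < a by exact: lt_trans va.
have s0 : 2 * sin (pi * v / a) != 0.
  rewrite mulf_neq0//; have p0 := pi_gt0 R.
  have [v1|v1|/eqP] := ltgtP v 0; last by rewrite -normr_eq0 gt_eqF.
  - rewrite -oppr_eq0 -sinN gt_eqF// sin_gt0_pi//; move: va; rewrite ltr0_norm// => va.
    rewrite -mulNr -mulrN divr_gt0 ?mulr_gt0 ?oppr_gt0//= ltr_pdivrMr// ltr_pM2l//.
  - rewrite gt_eqF// sin_gt0_pi//; move: va; rewrite gtr0_norm// => va.
    by rewrite divr_gt0 ?mulr_gt0//= ltr_pdivrMr// ltr_pM2l.
apply: continuous_comp; last by apply: continuous_ln; rewrite normr_gt0.
apply: continuous_comp; last exact: norm_continuous.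
apply: cvgM; first exact: cvg_cst.
apply: continuous_comp; last exact: continuous_sin.
by apply: cvgM; [apply: cvgM; [exact: cvg_cst|exact: cvg_id]|exact: cvg_cst].
Qed.

Lemma logsin_ge (a v : R) : 0 < a -> 0 < v <= a / 2 -> ln v - ln a <= logsin a v.
Proof.
move=> a0 /andP[v0 va]; have p0 := pi_gt0 R; have p2 := pi_ge2 R.
have w0 : 0 < pi * v / a by rewrite divr_gt0 ?mulr_gt0.
have wE : pi * v / a <= pi / 2.
  by rewrite ler_pdivrMr// -mulrA ler_pM2l//; lra.
have sw : pi * v / a / 2 <= sin (pi * v / a).
  by apply: sin_ge_half; rewrite ltW.
have s0 : 0 < sin (pi * v / a) by apply: lt_le_trans sw; rewrite divr_gt0.
rewrite /logsin gtr0_norm ?mulr_gt0// -ln_div ?posrE//.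
rewrite ler_ln ?posrE ?divr_gt0 ?mulr_gt0//.
apply: (@le_trans _ _ (2 * (pi * v / a / 2))); last by rewrite ler_pM2l.
rewrite mulrCA divff// mulr1 ler_pM2r ?invr_gt0// ler_peMl ?ltW//; lra.
Qed.

(** This is sin w <= w for w = pi v / a. It will keep [- logsin a] away from 0 on scales below sqrt
    a. *)
Lemma logsin_le_ln (a v : R) : 0 < v < a -> logsin a v <= ln v + ln (2 * pi) - ln a.
Proof.
move=> /andP[v0 va]; have a0 : 0 < a by exact: lt_trans va.
have p0 := pi_gt0 R; have w0 : 0 < pi * v / a by rewrite divr_gt0 ?mulr_gt0.
have s0 : 0 < sin (pi * v / a).
  by apply: sin_gt0_pi; rewrite w0/= ltr_pdivrMr// ltr_pM2l.
have sw := sin_le_id (ltW w0).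
rewrite /logsin gtr0_norm ?mulr_gt0// -lnM ?posrE ?mulr_gt0//.
rewrite -ln_div ?posrE ?mulr_gt0// ler_ln ?posrE ?divr_gt0 ?mulr_gt0//.
rewrite (_ : v * (2 * pi) / a = 2 * (pi * v / a)) ?ler_pM2l//.
by field; rewrite gt_eqF.
Qed.

Lemma logsin_mono (a u v : R) : 0 < a -> 0 < u -> u <= v -> v <= a / 2 ->
  logsin a u <= logsin a v.
Proof.
move=> a0 u0 uv va; have p0 := pi_gt0 R.
have v0 : 0 < v by exact: lt_le_trans uv.
have wu : 0 < pi * u / a by rewrite divr_gt0 ?mulr_gt0.
have wv : 0 < pi * v / a by rewrite divr_gt0 ?mulr_gt0.
have wuv : pi * u / a <= pi * v / a by rewrite ler_pM2r ?invr_gt0// ler_pM2l.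
have wvh : pi * v / a <= pi / 2 by rewrite ler_pdivrMr// -mulrA ler_pM2l//; lra.
have su : 0 < sin (pi * u / a) by apply: sin_gt0_pi; rewrite wu; lra.
have sv : 0 < sin (pi * v / a) by apply: sin_gt0_pi; rewrite wv; lra.
rewrite /logsin !gtr0_norm ?mulr_gt0// ler_ln ?posrE ?mulr_gt0// ler_pM2l//.
by rewrite leNgt ltr_sin -?leNgt// in_itv/=; apply/andP; split; lra.
Qed.

Lemma logsin_bound (a v : R) : 0 < a -> 0 <= v <= a / 2 ->
  `|logsin a v| <= ln 2 + `|ln a| + `|ln v|.
Proof.
move=> a0 /andP[]; rewrite le_eqVlt => /predU1P[<- _|v0 va].
  by rewrite /logsin mulr0 mul0r sin0 mulr0 normr0 ln0// normr0 !addr_ge0// ln_ge0// ler1n.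
have l2 : 0 <= ln 2 :> R by rewrite ln_ge0// ler1n.
have h1 := logsin_le a v; have h2 : ln v - ln a <= logsin a v by rewrite logsin_ge// v0.
have := ler_norm (ln a); have := ler_norm (- ln v); rewrite normrN => h3 h4.
have h5 := normr_ge0 (ln a); have h6 := normr_ge0 (ln v).
by rewrite ler_norml; apply/andP; split; lra.
Qed.

Lemma integrable_logsin_half (a u : R) : 0 < a -> u <= a / 2 ->
  mu.-integrable `[0, u] (EFin \o logsin a).
Proof.
move=> a0 ua.
apply: (@le_integrable _ _ _ mu _ _ _ (fun v => ((ln 2 + `|ln a|) + `|ln v|)%:E)) => //.
- by apply/measurable_EFinP; apply: measurable_funTS; exact: measurable_logsin.
- move=> v /=; rewrite in_itv/= => /andP[v0 vu].
  rewrite lee_fin; apply: (le_trans (logsin_bound a0 _)); first by rewrite v0; lra.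
  exact: ler_norm.
- by have := integrableD _ (integrable_cst_itv 0 u (ln 2 + `|ln a|)) (integrable_absln u); exact.
Qed.

Lemma integrable_logsin (a : R) : 0 < a -> mu.-integrable `[0, a] (EFin \o logsin a).
Proof.
move=> a0; have h := integrable_logsin_half a0 (lexx (a / 2)).
apply: (@integrable_itv_join _ _ (a / 2)) => //; [lra|lra|].
have := integrable_reflect a h.
rewrite (_ : a - a / 2 = a / 2) ?subr0; last lra.
rewrite (_ : EFin \o _ = EFin \o logsin a)//.
by apply/funext => v /=; rewrite logsin_reflect.
Qed.

Lemma Rintegral_logsin_half (a u : R) : 0 < a -> 1 <= u <= a / 2 ->
  \int[mu]_(v in `[0, u]) `|logsin a v| <= u * (ln 2 + `|ln a|) + (1 + u * ln u).
Proof.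
move=> a0 /andP[u1 ua]; have ci := integrable_cst_itv 0 u (ln 2 + `|ln a|).
have li := integrable_absln u.
apply: (@le_trans _ _ (\int[mu]_(v in `[0, u]) ((ln 2 + `|ln a|) + `|ln v|))).
  apply: le_Rintegral => //.
  - by apply: integrable_norm; exact: integrable_logsin_half.
  - by have := integrableD _ ci li; exact.
  - move=> v /=; rewrite in_itv/= => /andP[v0 vu].
    by apply: logsin_bound => //; rewrite v0; lra.
rewrite RintegralD// lerD ?Rintegral_absln//.
rewrite Rintegral_cst//= lebesgue_measure_itv/= lte_fin mulrC.
by rewrite ifT ?oppr0 ?addr0//; lra.
Qed.

(** End points are null sets. They have to be excluded because identities between logarithms break
    at zeros of the sine, where [ln 0 = 0]. *)
Lemma eq_Rintegral_oo (u v : R) (f g : R -> R) :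
  mu.-integrable `[u, v] (EFin \o f) -> mu.-integrable `[u, v] (EFin \o g) ->
  (forall x, u < x < v -> f x = g x) ->
  \int[mu]_(x in `[u, v]) f x = \int[mu]_(x in `[u, v]) g x.
Proof.
have oo h : mu.-integrable `[u, v] (EFin \o h) ->
    \int[mu]_(x in `[u, v]) h x = \int[mu]_(x in `]u, v[) h x.
  move=> hi; rewrite -Rintegral_itv_obnd_cbnd; last first.
    by apply: integrableS hi => //; apply: subset_itv; rewrite bnd_simp.
  rewrite -Rintegral_itv_bndo_bndc//.
  by apply: integrableS hi => //; apply: subset_itv; rewrite bnd_simp.
move=> fi gi fg; rewrite !oo//; apply: eq_Rintegral => x.
by rewrite inE/= in_itv/= => /fg.
Qed.

(* Doubling: logsin a (2 v) = logsin a v + logsin a (v + a / 2), so the integral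
   equals twice itself. *)
Lemma Rintegral_logsin (a : R) : 0 < a -> \int[mu]_(v in `[0, a]) logsin a v = 0.
Proof.
move=> a0; have fi := integrable_logsin a0.
set J := (LHS).
have n2 : 2 != 0 :> R by [].
have n1 : 1 != 0 :> R by [].
have P2 : (fun v => 2 * v + 0) @^-1` `[0, a] = `[0, a / 2]%classic.
  by apply/seteqP; split=> v/=; rewrite !in_itv/= => /andP[? ?]; apply/andP; split; lra.
have P3 : (fun v => 1 * v + a / 2) @^-1` `[a / 2, a] = `[0, a / 2]%classic.
  by apply/seteqP; split=> v/=; rewrite !in_itv/= => /andP[? ?]; apply/andP; split; lra.
have F2 : (fun v => logsin a (2 * v)) = (fun v => logsin a (2 * v + 0)).
  by apply/funext => v; rewrite addr0.
have F3 : (fun v => logsin a (v + a / 2)) = (fun v => logsin a (1 * v + a / 2)).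
  by apply/funext => v; rewrite mul1r.
have hi : mu.-integrable `[a / 2, a] (EFin \o logsin a).
  by apply: integrable_subitv fi => //; lra.
have i2 : mu.-integrable `[0, a / 2] (EFin \o (fun v => logsin a (2 * v))).
  by rewrite -P2 F2; exact: (integrable_affine 0 n2 _ fi).
have i3 : mu.-integrable `[0, a / 2] (EFin \o (fun v => logsin a (v + a / 2))).
  by rewrite -P3 F3; exact: (integrable_affine (a / 2) n1 _ hi).
have E2 : \int[mu]_(v in `[0, a / 2]) logsin a (2 * v) = 2^-1 * J.
  by rewrite -P2 F2 (Rintegral_affine 0 n2 _ fi)// ger0_norm.
have E3 : \int[mu]_(v in `[0, a / 2]) logsin a (v + a / 2) =
    \int[mu]_(v in `[a / 2, a]) logsin a v.
  by rewrite -P3 F3 (Rintegral_affine (a / 2) n1 _ hi)// normr1 invr1 mul1r.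
have i1 := integrable_logsin_half a0 (lexx (a / 2)).
have : 2^-1 * J = J.
  rewrite -E2 /J (Rintegral_itv_split (m := a / 2) _ _ fi); [|lra|lra].
  rewrite -E3 -RintegralD//; apply: eq_Rintegral_oo => //.
    by have := integrableD _ i1 i3; exact.
  (* For 0 < v < a / 2 the angle w lies strictly between 0 and pi / 2, so sin w and cos w are both
     positive and sin(2 w) = 2 sin w cos w can be split under the logarithm. *)
  move=> v /andP[v0 va].
  have p0 := pi_gt0 R; set w := pi * v / a.
  have w0 : 0 < w by rewrite divr_gt0 ?mulr_gt0.
  have w1 : w < pi / 2 by rewrite ltr_pdivrMr// -mulrA ltr_pM2l//; lra.
  have sw : 0 < sin w by apply: sin_gt0_pi; rewrite w0; lra.
  have cw : 0 < cos w by apply: cos_gt0_pihalf; rewrite w1 andbT; lra.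
  rewrite /logsin (_ : pi * (2 * v) / a = w *+ 2); last by rewrite /w; field; rewrite gt_eqF.
  rewrite (_ : pi * (v + a / 2) / a = w + pi / 2); last by rewrite /w; field; rewrite gt_eqF.
  rewrite sin_mulr2n sinDpihalf -/w !gtr0_norm ?mulr_gt0 ?mulrn_wgt0 ?mulr_gt0//.
  by rewrite -lnM ?posrE ?mulr_gt0//; congr ln; ring.
lra.
Qed.

(** The difference is ln(sin w / w) with w = pi v / a. It is nonpositive since sin w <= w. From sin
    w >= w cos w >= w (1 - w^2 / 2) one gets w / sin w <= 1 + w^2 for w <= 1, and ln(1 + w^2) <=
    w^2. *)
Lemma logsin_approx (a v : R) : 0 < a -> 0 < v -> pi * v / a <= 1 ->
  `|logsin a v - (ln v + ln (2 * pi / a))| <= (pi * v / a) ^+ 2.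
Proof.
move=> a0 v0; set w := pi * v / a => w1; have p0 := pi_gt0 R; have p2 := pi_ge2 R.
have w0 : 0 < w by rewrite divr_gt0 ?mulr_gt0.
have wp : 0 <= w <= pi by rewrite ltW//=; lra.
have := sin_ge_mulcos wp; have := cos_ge_quadratic wp; have := sin_le_id (ltW w0).
rewrite /logsin -/w => s1 c1 s2.
have s3 : w * (1 - w ^+ 2 / 2) <= sin w by apply: le_trans s2; rewrite ler_pM2l.
have q0 : 0 < 1 - w ^+ 2 / 2 by nra.
have s0 : 0 < sin w by apply: lt_le_trans s3; rewrite mulr_gt0.
have pa : 0 < 2 * pi / a by rewrite divr_gt0 ?mulr_gt0.
have s20 : 0 < 2 * sin w by rewrite mulr_gt0.
have w20 : 0 < 2 * w by rewrite mulr_gt0.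
rewrite -lnM ?posrE//.
have -> : v * (2 * pi / a) = 2 * w by rewrite /w; field; rewrite gt_eqF.
rewrite [`|2 * sin w|]gtr0_norm// -ln_div ?posrE//.
have -> : 2 * sin w / (2 * w) = sin w / w by field; rewrite gt_eqF.
have l1 : ln (sin w / w) <= 0 by rewrite ln_le0// ler_pdivrMr// mul1r.
rewrite ler0_norm// -lnV; last by rewrite posrE divr_gt0.
rewrite invf_div.
(* [h1] and [h2] supply the products that make the last inequality, [w <= (1 + w ^+ 2) * sin w], a
   linear consequence. *)
have h1 : 0 <= (1 + w ^+ 2) * (sin w - w * (1 - w ^+ 2 / 2)).
  by rewrite mulr_ge0// ?subr_ge0// addr_ge0// sqr_ge0.
have h2 : 0 <= w * w ^+ 2 * (1 - w ^+ 2).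
  apply: mulr_ge0; first by rewrite mulr_ge0 ?sqr_ge0// ltW.
  by rewrite subr_ge0 expr_le1// ltW.
have h3 : 0 <= w ^+ 2 by exact: sqr_ge0.
apply: (@le_trans _ _ (ln (1 + w ^+ 2))); last by apply: le_ln1Dx; lra.
have ws0 : 0 < w / sin w by exact: divr_gt0.
rewrite ler_ln ?posrE//; last lra.
by rewrite ler_pdivrMr//; lra.
Qed.

End log_sine.

(** * Bonnet's inequality and averages of primitives *)

Section bonnet.
Context {R : realType}.
Local Notation mu := (@lebesgue_measure R).

(** The sum is the ceiling of x. It provides the staircase approximation in Bonnet's inequality. *)
Lemma sum_ltn_indicator (n : nat) (x : R) : 0 <= x <= n%:R ->
  x <= \sum_(k < n) ((k%:R < x)%R)%:R <= x + 1.
Proof.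
move=> /andP[x0]; elim: n => [|n IH] xn.
  by rewrite big_ord0; apply/andP; split; lra.
rewrite big_ord_recr/=; have [nx|xn'] := ltP n%:R x; last by rewrite addr0; exact: IH.
rewrite (eq_bigr (fun=> 1)); last first.
  by move=> k _; rewrite (lt_trans _ nx)// ltr_nat.
rewrite sumr_const card_ord natr1; move: xn; rewrite -natr1 => xn.
by apply/andP; split; lra.
Qed.

Lemma Rintegral_sum (D : set R) (m : nat) (f : nat -> R -> R) : measurable D ->
  (forall k, mu.-integrable D (EFin \o f k)) ->
  mu.-integrable D (EFin \o (fun v => \sum_(k < m) f k v)) /\
  \int[mu]_(v in D) (\sum_(k < m) f k v) = \sum_(k < m) \int[mu]_(v in D) f k v.
Proof.
move=> mD fi; elim: m => [|m [IHi IH]].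
  rewrite big_ord0 (_ : (fun v => _) = fun=> 0); last first.
    by apply/funext => v; rewrite big_ord0.
  by rewrite Rintegral_cst// mul0r; split => //; exact: integrable0.
rewrite big_ord_recr/= -IH (_ : (fun v => _) = (fun v => \sum_(k < m) f k v + f m v)); last first.
  by apply/funext => v; rewrite big_ord_recr.
by split; [have := integrableD _ IHi (fi m); exact|rewrite RintegralD].
Qed.

(** Within [a, b] an up-set is, up to its left end point, the interval from its infimum to b, so the
    integral is one of the tails bounded by S. An empty up-set gives 0. *)
Lemma Rintegral_upset_le (a b S : R) (E : set R) (h : R -> R) : a <= b -> measurable E ->
  mu.-integrable `[a, b] (EFin \o h) ->
  (forall u v, a <= u -> u <= v -> v <= b -> E u -> E v) ->
  (forall s, a <= s <= b -> `|\int[mu]_(v in `[s, b]) h v| <= S) ->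
  `|\int[mu]_(v in `[a, b]) (\1_E v * h v)| <= S.
Proof.
move=> ab mE hi up hS.
have S0 : 0 <= S by apply: le_trans (hS b _); rewrite ?normr_ge0// ab lexx.
have ei : mu.-integrable `[a, b] (EFin \o (fun v => \1_E v * h v)).
  apply: (integrable_bounded_mul (M := 1)) => //.
  by move=> x _; rewrite indicE; case: (_ \in _); rewrite /= ?normr1 ?normr0.
pose F := E `&` `[a, b].
have [[x0 Fx0]|F0] := pselect (exists x, F x); last first.
  rewrite (eq_Rintegral _ (g := fun=> 0)); last first.
    move=> x xab; rewrite indicE memNset ?mul0r// => Ex; apply: F0; exists x.
    by split => //; rewrite -inE.
  by rewrite Rintegral_cst// mul0r normr0.
have hF : has_inf F.
  by split; [exists x0|exists a => x [_] /=; rewrite in_itv/= => /andP[]].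
pose s := inf F.
have as_ : a <= s.
  by apply: lb_le_inf; [exists x0|move=> x [_] /=; rewrite in_itv/= => /andP[]].
have sb : s <= b.
  have : s <= x0 by apply: ge_inf => //; case: hF.
  by move=> /le_trans; apply; case: Fx0 => _ /=; rewrite in_itv/= => /andP[].
rewrite (Rintegral_itv_split as_ sb)//.
rewrite (@eq_Rintegral_oo _ a s _ (fun=> 0)); first last.
- move=> x /andP[ax xs]; rewrite indicE memNset ?mul0r// => Ex.
  have : s <= x.
    apply: ge_inf; first by case: hF.
    by split => //=; rewrite in_itv/=; apply/andP; split; lra.
  by rewrite leNgt xs.
- exact: integrable_cst_itv.
- by apply: integrable_subitv ei.
rewrite Rintegral_cst// mul0r add0r (@eq_Rintegral_oo _ s b _ h); first last.
- move=> x /andP[sx xb]; rewrite indicE mem_set ?mul1r//.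
  have [y Fy yx] := inf_lt hF.1 sx.
  case: Fy => Ey /=; rewrite in_itv/= => /andP[ay _].
  by apply: (up y x) => //; lra.
- by apply: integrable_subitv hi.
- by apply: integrable_subitv ei.
by apply: hS; rewrite as_.
Qed.

(* Abel summation: approximate phi by K / n times a sum of n indicators of
   up-sets. *)
Lemma bonnet (a b K S : R) (phi h : R -> R) : a <= b -> 0 < K ->
  measurable_fun [set: R] phi ->
  (forall v, a <= v <= b -> 0 <= phi v <= K) ->
  (forall u v, a <= u -> u <= v -> v <= b -> phi u <= phi v) ->
  mu.-integrable `[a, b] (EFin \o h) ->
  (forall s, a <= s <= b -> `|\int[mu]_(v in `[s, b]) h v| <= S) ->
  `|\int[mu]_(v in `[a, b]) (phi v * h v)| <= K * S.
Proof.
move=> ab K0 mphi phiK mono hi hS.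
set I := \int[mu]_(v in `[a, b]) (phi v * h v).
pose J := \int[mu]_(v in `[a, b]) `|h v|.
have phii : mu.-integrable `[a, b] (EFin \o (fun v => phi v * h v)).
  apply: (integrable_bounded_mul (M := K)) => //; first exact: measurable_funTS.
  by move=> x /=; rewrite in_itv/= => /phiK/andP[? ?]; rewrite ger0_norm.
(* The level set phi > k K / (n + 1), an up-set within [a, b] because phi is nondecreasing there. *)
pose E n k := [set v | k%:R < phi v * (n.+1%:R / K)].
have mE n k : measurable (E n k).
  rewrite (_ : E n k = (fun v => phi v * (n.+1%:R / K)) @^-1` `]k%:R, +oo[).
    rewrite -[X in measurable X]setTI; apply: measurable_funM => //.
  by apply/seteqP; split=> x /=; rewrite in_itv/= andbT.
have ki n k : mu.-integrable `[a, b] (EFin \o (fun v => \1_(E n k) v * h v)).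
  apply: (integrable_bounded_mul (M := 1)) => //.
  by move=> x _; rewrite indicE; case: (_ \in _); rewrite /= ?normr1 ?normr0.
(* The n + 1 levels, each of weight d = K / (n + 1), contribute at most K S in total; the staircase
   misses phi by at most d pointwise, which costs d J. *)
have key n : `|I| <= K * S + K / n.+1%:R * J.
  pose d := K / n.+1%:R; have d0 : 0 < d by rewrite divr_gt0.
  have dK : n.+1%:R / K * d = 1 by rewrite /d mulrA divfK ?gt_eqF// mulfV.
  pose s v := \sum_(k < n.+1) \1_(E n k) v * h v.
  have [si sE] := @Rintegral_sum `[a, b]%classic n.+1 _ (measurable_itv _) (ki n).
  have dsi : mu.-integrable `[a, b] (EFin \o (fun v => d * s v)).
    by have := integrableZl _ d si; exact.
  have -> : I = \int[mu]_(v in `[a, b]) (d * s v) +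
      \int[mu]_(v in `[a, b]) (phi v * h v - d * s v).
    by rewrite RintegralB// addrC subrK.
  apply: le_trans (ler_normD _ _) _; apply: lerD.
    rewrite RintegralZl// normrM gtr0_norm// sE.
    apply: (@le_trans _ _ (d * \sum_(k < n.+1) S)).
      rewrite ler_pM2l//; apply: le_trans (ler_norm_sum _ _ _) _.
      apply: ler_sum => k _; apply: Rintegral_upset_le => //.
      move=> u v au uv vb; rewrite /E/= => /lt_le_trans; apply.
      by rewrite ler_wpM2r ?mono// divr_ge0//; exact: ltW.
    rewrite sumr_const card_ord -mulr_natl mulrA.
    by rewrite /d divfK ?gt_eqF.
  have dJ : mu.-integrable `[a, b] (EFin \o (fun v => d * `|h v|)).
    by have := integrableZl _ d (integrable_norm hi); exact.
  rewrite -[K / n.+1%:R]/d /J -RintegralZl//; last exact: integrable_norm.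
  apply: norm_Rintegral_le => //.
    by have := integrableB _ phii dsi; exact.
  move=> v /=; rewrite in_itv/= => vab.
  have -> : phi v * h v - d * s v =
      (phi v - d * \sum_(k < n.+1) \1_(E n k) v) * h v.
    by rewrite mulrBl -(mulrA d) mulr_suml.
  rewrite normrM ler_wpM2r//.
  have /andP[p0 pK] := phiK v vab.
  have xn : 0 <= phi v * (n.+1%:R / K) <= n.+1%:R.
    apply/andP; split; first by rewrite mulr_ge0// divr_ge0// ltW.
    by rewrite mulrA ler_pdivrMr// mulrC ler_pM2l.
  have := sum_ltn_indicator xn.
  rewrite (eq_bigr (fun k : 'I_n.+1 => \1_(E n k) v)); last first.
    by move=> k _; rewrite indicE mem_setE.
  move: (\sum_(k < _) _) => t /andP[t1 t2].
  have : d * (phi v * (n.+1%:R / K)) = phi v by rewrite mulrCA (mulrC d) dK mulr1.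
  move: t1 t2; move: (phi v * (n.+1%:R / K)) => x t1 t2 <-.
  by rewrite ler_norml; apply/andP; split; nra.
apply/ler_addgt0Pr => e e0.
have J0 : 0 <= J by apply: Rintegral_ge0.
(* Then K J / e <= n + 1, so the staircase error is at most e. *)
pose n := Num.truncn (K * J / e).
have KJ : 0 <= K * J / e by rewrite divr_ge0 ?mulr_ge0// ltW.
have /andP[_ /ltW] := truncn_itv KJ; rewrite -/n ler_pdivrMr// => H.
apply: le_trans (key n) _; rewrite lerD2l mulrAC ler_pdivrMr//.
by rewrite (mulrC e).
Qed.

End bonnet.

(** * The triangle integral as an average of primitives *)

Section triangle_estimate.
Context {R : realType}.
Local Notation mu := (@lebesgue_measure R).

Lemma norm_Rintegral_cst_le (u v K : R) (f : R -> R) : u <= v ->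
  mu.-integrable `[u, v] (EFin \o f) -> (forall x, u <= x <= v -> `|f x| <= K) ->
  `|\int[mu]_(x in `[u, v]) f x| <= K * (v - u).
Proof.
move=> uv fi fK.
apply: le_trans (norm_Rintegral_le (g := fun=> K) _ fi _ _) _ => //.
- exact: integrable_cst_itv.
rewrite Rintegral_cst//= lebesgue_measure_itv/= lte_fin; case: ifPn => // uv'.
by rewrite /= (_ : v - u = 0) ?mulr0//; lra.
Qed.

(* The inner integrals are within e of the one up to alpha, except on the two
   end pieces of length alpha. *)
Lemma triangle_estimate (f : R -> R) (a alpha e B : R) :
  0 < a -> 0 <= alpha -> alpha <= a - alpha ->
  mu.-integrable `[0, a] (EFin \o f) ->
  (forall A, alpha <= A <= a - alpha -> `|\int[mu]_(v in `[alpha, A]) f v| <= e) ->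
  \int[mu]_(v in `[0, alpha]) `|f v| <= B ->
  \int[mu]_(v in `[a - alpha, a]) `|f v| <= B ->
  `|triangle_integral f a / a - 2 * \int[mu]_(v in `[0, alpha]) f v| <=
    2 * e + 4 * (B + e) * (alpha / a).
Proof.
move=> a0 al0 ala fi mid B1 B2.
have e0 : 0 <= e by apply: le_trans (mid alpha _); rewrite ?normr_ge0// lexx.
pose F x := \int[mu]_(v in `[0, x]) f v; rewrite -/(F alpha).
have fiu u v : 0 <= u -> v <= a -> mu.-integrable `[u, v] (EFin \o f).
  by move=> u0 va; exact: integrable_subitv fi.
have FB u v : 0 <= u -> u <= v -> v <= a -> F v = F u + \int[mu]_(t in `[u, v]) f t.
  by move=> u0 uv va; rewrite /F (Rintegral_itv_split u0 uv)//; apply: fiu.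
have nB u v u' v' : 0 <= u -> u <= u' -> v' <= v -> v <= a ->
    \int[mu]_(t in `[u, v]) `|f t| <= B -> `|\int[mu]_(t in `[u', v']) f t| <= B.
  move=> u0 uu vv va; apply: le_trans.
  apply: le_trans (le_normr_Rintegral _ _) _ => //; first by apply: fiu; lra.
  have := @ge0_subset_integral _ _ _ mu `[u', v']%classic `[u, v]%classic _ _ (fun t => `|f t|%:E).
  move=> H; rewrite /Rintegral fine_le//.
  - by apply: integrable_fin_num => //; apply: integrable_norm; apply: fiu; lra.
  - by apply: integrable_fin_num => //; apply: integrable_norm; exact: fiu.
  - apply: H => //.
      by apply/measurable_EFinP; apply: measurableT_comp => //;
        have /integrableP[/measurable_EFinP] := fiu u v u0 va.
    by apply: subset_itv; rewrite bnd_simp.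
(* The worst case is x > a - alpha: going from alpha to x costs e across the middle and B on the end
   piece. *)
have dF x : 0 <= x <= a -> `|F x - F alpha| <= B + e.
  move=> /andP[x0 xa].
  have [xal|/ltW alx] := leP x alpha.
    have -> : F x - F alpha = - \int[mu]_(t in `[x, alpha]) f t.
      by rewrite (FB x alpha)//; lra.
    rewrite normrN; apply: (@le_trans _ _ B); last lra.
    by apply: nB B1; lra.
  have [xm|/ltW mx] := leP x (a - alpha).
    rewrite (FB alpha x)// addrC addKr; apply: (@le_trans _ _ e); first by apply: mid; rewrite alx.
    have : 0 <= B by apply: le_trans B1; exact: Rintegral_ge0.
    lra.
  rewrite (FB (a - alpha) x) ?(FB alpha (a - alpha))//; try lra.
  have -> : forall p q r : R, p + q + r - p = r + q by move=> *; lra.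
  apply: le_trans (ler_normD _ _) _; apply: lerD; last by apply: mid; rewrite lexx andbT.
  by apply: nB B2; lra.
have dFm x : alpha <= x <= a - alpha -> `|F x - F alpha| <= e.
  by move=> /andP[alx xm]; rewrite (FB alpha x)//; [rewrite addrC addKr mid// alx|lra].
(* The constant 2 F(alpha) is moved under the integral, so that the quantity to bound is the mean of
   [G] over [0, a]. *)
pose G x := (F x - F alpha) + (F (a - x) - F alpha).
have Gi : mu.-integrable `[0, a] (EFin \o G).
  rewrite (_ : G = fun x => (F x + F (a - x)) - 2 * F alpha); last first.
    by apply/funext => x; rewrite /G; lra.
  have := integrableB _ (integrable_triangle (ltW a0) fi) (integrable_cst_itv 0 a (2 * F alpha)).
  exact.
have GE : triangle_integral f a / a - 2 * F alpha = (\int[mu]_(x in `[0, a]) G x) / a.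
  have -> : \int[mu]_(x in `[0, a]) G x = triangle_integral f a - 2 * F alpha * a.
    transitivity (\int[mu]_(x in `[0, a]) ((F x + F (a - x)) - 2 * F alpha)).
      by apply: eq_Rintegral => x _; rewrite /G; lra.
    rewrite RintegralB//; last 2 first.
    - exact: integrable_triangle (ltW a0) fi.
    - exact: integrable_cst_itv.
    rewrite Rintegral_cst//= lebesgue_measure_itv/= lte_fin a0 oppr0 addr0//.
  by rewrite mulrBl mulfK// gt_eqF.
rewrite GE normrM normfV (gtr0_norm a0) ler_pdivrMr//.
have i1 : mu.-integrable `[0, a - alpha] (EFin \o G) by apply: integrable_subitv Gi; lra.
rewrite (Rintegral_itv_split (m := a - alpha) _ _ Gi); [|lra|lra].
rewrite (Rintegral_itv_split (m := alpha) _ _ i1); [|lra|lra].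
(* The map x -> a - x exchanges the two end pieces and preserves the middle, so both summands of [G]
   obey the weak bound on an end piece and the strong one in the middle. *)
have b1 : `|\int[mu]_(x in `[0, alpha]) G x| <= 2 * (B + e) * (alpha - 0).
  apply: norm_Rintegral_cst_le => //; first by apply: integrable_subitv Gi; lra.
  move=> x /andP[x0 xa]; apply: le_trans (ler_normD _ _) _.
  have h1 : `|F x - F alpha| <= B + e by apply: dF; apply/andP; split; lra.
  have h2 : `|F (a - x) - F alpha| <= B + e by apply: dF; apply/andP; split; lra.
  lra.
have b2 : `|\int[mu]_(x in `[alpha, a - alpha]) G x| <= 2 * e * (a - alpha - alpha).
  apply: norm_Rintegral_cst_le => //; first by apply: integrable_subitv Gi; lra.
  move=> x /andP[x0 xa]; apply: le_trans (ler_normD _ _) _.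
  have h1 : `|F x - F alpha| <= e by apply: dFm; apply/andP; split; lra.
  have h2 : `|F (a - x) - F alpha| <= e by apply: dFm; apply/andP; split; lra.
  lra.
have b3 : `|\int[mu]_(x in `[a - alpha, a]) G x| <= 2 * (B + e) * (a - (a - alpha)).
  apply: norm_Rintegral_cst_le => //; [lra|by apply: integrable_subitv Gi; lra|].
  move=> x /andP[x0 xa]; apply: le_trans (ler_normD _ _) _.
  have h1 : `|F x - F alpha| <= B + e by apply: dF; apply/andP; split; lra.
  have h2 : `|F (a - x) - F alpha| <= B + e by apply: dF; apply/andP; split; lra.
  lra.
apply: le_trans (ler_normD _ _) _; apply: le_trans (lerD (ler_normD _ _) (lexx _)) _.
rewrite mulrDl -[4 * _ * _ * a]mulrA divfK ?gt_eqF//.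
have : 0 <= e * alpha by rewrite mulr_ge0.
lra.
Qed.

End triangle_estimate.

(** * Number variance and expected energy *)

Section pair_correlation.
Context {R : realType} {d : measure_display} {T : measurableType d}.
Context {P : probability T R} {X : T -> config R}.
Context {rho1 : 1.-tuple R -> R} {rho2 : 2.-tuple R -> R} {T2 : R -> R} {M : R}.
Context (processX : simple_point_process X).
Context (corr1 : correlation_function P X rho1).
Context (corr2 : correlation_function P X rho2).
Context (rho1E : forall x, rho1 [tuple x] = 1).
Context (rho2E : forall x y, rho2 [tuple x; y] = 1 - T2 (x - y)).
Context (T2_le : forall v, `|T2 v| <= M).
Local Notation mu := (@lebesgue_measure R).

Lemma measurable_T2 : measurable_fun [set: R] T2.
Proof.
have mr := @measurable_pair_density _ _ _ _ _ _ (fun v => 1 - T2 v) corr2 rho2E.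
rewrite (_ : T2 = fun v => 1 - (1 - T2 v)); last by apply/funext => v; lra.
exact: measurable_funB.
Qed.

Lemma integrable_T2_mul (D : set R) (g : R -> R) : measurable D ->
  mu.-integrable D (EFin \o g) -> mu.-integrable D (EFin \o (fun v => T2 v * g v)).
Proof.
move=> mD; apply: (integrable_bounded_mul (M := M)) => //.
exact: measurable_funTS measurable_T2.
Qed.

Lemma integrable_T2 (u v : R) : mu.-integrable `[u, v] (EFin \o T2).
Proof. exact: integrable_bounded_itv measurable_T2 T2_le. Qed.

Lemma pair_density_mul (D : set R) (g : R -> R) : measurable D ->
  mu.-integrable D (EFin \o g) ->
  mu.-integrable D (EFin \o (fun v => g v * (1 - T2 v))).
Proof.
move=> mD gi; have := integrableB _ gi (integrable_T2_mul mD gi).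
rewrite (_ : (fun v => g v * (1 - T2 v)) = (fun v => g v - T2 v * g v)); last first.
  by apply/funext => v; lra.
exact.
Qed.

Lemma triangle_integral_cst (k a : R) : 0 <= a ->
  triangle_integral (fun=> k) a = k * a ^+ 2.
Proof.
move=> a0; transitivity (\int[mu]_(x in `[0, a]) (k * a)).
  apply: eq_Rintegral => x; rewrite inE/= in_itv/= => /andP[x0 xa].
  have lenE u : 0 <= u -> fine (mu `[0, u]) = u.
    rewrite lebesgue_measure_itv/= lte_fin; case: ifPn => /= u0' u0; first lra.
    by rewrite -leNgt in u0'; lra.
  by rewrite !Rintegral_cst// !lenE; lra.
rewrite Rintegral_cst//= lebesgue_measure_itv/= lte_fin.
case: ifPn => /= a0'; first by rewrite oppr0 addr0; ring.
by rewrite -leNgt in a0'; rewrite (_ : a = 0); [ring|lra].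
Qed.

Section number_variance.
Context (a : R).
Context (a0 : 0 < a).
Let n w : R := \sum_(x \in X w `&` `[0, a]) (1 : R).

Let number_expectation : P.-integrable [set: T] (EFin \o n) /\
  \int[P]_w n w = a.
Proof.
have n0 w : 0 <= n w by rewrite /n fsbig_finite ?sumr_ge0//; exact: finite_window.
have E : (\int[P]_w (n w)%:E = a%:E)%E.
  pose f x : \bar R := (\1_(`[0, a]%classic : set R) x)%:E.
  transitivity (\int[P]_w (\esum_(x in X w) f x))%E.
    apply: eq_integral => w _; have fA := finite_window processX w 0 a.
    rewrite (eq_esum (b := fun x => if x \in `[0, a]%classic then 1%E else 0%E)); last first.
      by move=> x _; rewrite /f indicE; case: (_ \in _).
    by rewrite -esum_mkcondr esum_fset// fsumEFin.
  rewrite (integral_esum1 corr1)//; last first.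
  - by move=> x; rewrite lee_fin.
  - by apply/measurable_EFinP; exact: measurable_indic.
  under eq_integral do rewrite rho1E mule1.
  rewrite integral_indic// setIT /= lebesgue_measure_itv/= lte_fin a0.
  by rewrite oppr0 adde0.
split; last by rewrite /Rintegral E.
apply/integrableP; split.
  by apply/measurable_EFinP; apply: (measurable_count processX (a := 0) (b := a)).
under eq_integral do rewrite /= ger0_norm//.
by rewrite E ltry.
Qed.

Let pair_sum1 w : pair_sum (X := X) (fun=> 1) a w = n w ^+ 2 - n w.
Proof.
have fA := finite_window processX w 0 a.
rewrite /pair_sum (distinct_pairs_sum (fun=> 1))// /n fsbig_finite//=.
set s := finmap.enum_fset _; have us : uniq s by exact: finmap.fset_uniq.
transitivity (\sum_(x <- s) (\sum_(y <- s) (1 : R) - 1)).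
  rewrite big_seq [RHS]big_seq; apply: eq_bigr => x xs.
  rewrite (bigD1_seq x)//= eqxx add0r [in RHS](bigD1_seq x)//= [1 + _]addrC addrK.
  by apply: eq_bigr => y; rewrite eq_sym => ->.
rewrite sumrB expr2 mulr_suml; congr (_ - _).
by apply: eq_bigr => x _; rewrite mul1r.
Qed.

(** The number n of points in [0, a] has E n = a and E (n^2 - n) = a^2 - [triangle_integral T2 a],
    so its variance E (n - a)^2 is a - [triangle_integral T2 a]. *)
Lemma triangle_T2_le : triangle_integral T2 a <= a.
Proof.
have [ni nE] := number_expectation.
have ci := integrable_cst_itv 0 a 1.
have [pi_ pE] := @ge0_pair_sum_expectation _ _ _ _ _ _ (fun v => 1 - T2 v)
  processX corr2 rho2E (fun=> 1) a a0 (measurable_cst _)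
  (fun=> ler01) (fun=> erefl) (fun _ _ => cvg_cst _)
  (pair_density_mul (measurable_itv _) ci).
have triE : triangle_integral (fun v => 1 * (1 - T2 v)) a = a ^+ 2 - triangle_integral T2 a.
  rewrite (_ : (fun v => _) = (fun v => 1 - T2 v)); last by apply/funext => v; rewrite mul1r.
  rewrite (triangle_integralB (ltW a0) ci (integrable_T2 0 a)) triangle_integral_cst ?ltW//.
  by rewrite mul1r.
have kn : P.-integrable [set: T] (EFin \o (fun w => (1 - 2 * a) * n w)).
  by have := integrableZl _ (1 - 2 * a) ni; exact.
have kc : P.-integrable [set: T] (EFin \o (fun=> a ^+ 2)).
  exact: finite_measure_integrable_cst.
have kk : P.-integrable [set: T] (EFin \o (fun w => (1 - 2 * a) * n w + a ^+ 2)).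
  by have := integrableD _ kn kc; exact.
have : 0 <= \int[P]_w (pair_sum (X := X) (fun=> 1) a w + ((1 - 2 * a) * n w + a ^+ 2)).
  apply: Rintegral_ge0 => w _; rewrite pair_sum1.
  have -> : n w ^+ 2 - n w + ((1 - 2 * a) * n w + a ^+ 2) = (n w - a) ^+ 2.
    by move: (n w) => k; ring.
  exact: sqr_ge0.
rewrite RintegralD// RintegralD// RintegralZl// nE Rintegral_cst//= probability_setT.
by rewrite [X in X + _]/Rintegral pE/= triE; lra.
Qed.

End number_variance.

(** Divided by a, the triangle integral of [T2] is at most 1, while for large a it is close to twice
    the integral of [T2] over [0, al], hence to 2 p. *)
Lemma triangle_T2_average_le (p : R) :
  (\int[mu]_(v in `[0, A]) T2 v) @[A --> +oo] --> p -> 2 * p <= 1.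
Proof.
move=> cvgp; rewrite leNgt; apply/negP => p1.
(* The losses are 2e from replacing p by the integral up to al, 4e from the middle range (two
   primitives within e of p differ by at most 2e, counted twice), and e from the end pieces: 7e in
   all, less than 2 p - 1 = 8e. *)
pose e := (2 * p - 1) / 8; have e0 : 0 < e by rewrite divr_gt0 ?subr_gt0.
have /cvgrPdist_le/(_ e e0) [A0 [_ HA]] := cvgp.
pose al := Num.max 0 (A0 + 1).
have al0 : 0 <= al by rewrite le_max lexx.
have HA' A : al <= A -> `|p - \int[mu]_(v in `[0, A]) T2 v| <= e.
  by move=> alA; apply: HA; apply: lt_le_trans alA; rewrite lt_max; apply/orP; right; lra.
have M0 : 0 <= M by apply: le_trans (T2_le 0).
have Bu u v : u <= v -> \int[mu]_(x in `[u, v]) `|T2 x| <= M * (v - u).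
  move=> uv; apply: le_trans (ler_norm _) _.
  apply: norm_Rintegral_cst_le => //; first exact: integrable_norm (integrable_T2 _ _).
  by move=> x _; rewrite normr_id.
pose B := M * al; pose D := 4 * (B + 2 * e) * al.
have D0 : 0 <= D by rewrite !mulr_ge0// addr_ge0// mulr_ge0// ltW.
(* Large enough for al <= a - al and for the end-piece term D / a to be at most e. *)
pose a := 2 * al + 1 + D / e.
have Da : 0 <= D / e by rewrite divr_ge0// ltW.
have a0 : 0 < a by rewrite /a; lra.
have ala : al <= a - al by rewrite /a; lra.
have := @triangle_estimate R T2 a al (2 * e) B a0 al0 ala (integrable_T2 0 a).
have H1 A : al <= A <= a - al -> `|\int[mu]_(v in `[al, A]) T2 v| <= 2 * e.
  move=> /andP[alA _]; have := HA' A alA; have := HA' al (lexx _).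
  rewrite (Rintegral_itv_split al0 alA (integrable_T2 0 A)).
  move: (Rintegral _ _ _) (Rintegral _ _ _) => u v.
  by rewrite !ler_norml => /andP[? ?] /andP[? ?]; apply/andP; split; lra.
have H2 : \int[mu]_(v in `[0, al]) `|T2 v| <= B.
  by have := Bu 0 al al0; rewrite subr0.
have H3 : \int[mu]_(v in `[(a - al), a]) `|T2 v| <= B.
  by have := Bu (a - al) a; rewrite (_ : a - (a - al) = al); [apply; lra|lra].
move=> /(_ H1 H2 H3).
have tri1 : triangle_integral T2 a / a <= 1.
  by rewrite ler_pdivrMr// mul1r; exact: triangle_T2_le.
have Dsmall : 4 * (B + 2 * e) * (al / a) <= e.
  rewrite mulrA ler_pdivrMr// -[X in X <= _]/D.
  have -> : D = e * (D / e) by rewrite mulrC divfK ?gt_eqF.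
  by rewrite ler_pM2l// /a; lra.
have := HA' al (lexx _); rewrite !ler_norml => /andP[? ?] /andP[? ?].
have : 2 * p - 1 = 8 * e by rewrite /e; field.
lra.
Qed.

End pair_correlation.

Section energy.
Context {R : realType} {d : measure_display} {T : measurableType d}.
Context {P : probability T R} {X : T -> config R}.
Context {rho2 : 2.-tuple R -> R} {T2 : R -> R} {M : R}.
Context (processX : simple_point_process X).
Context (corr2 : correlation_function P X rho2).
Context (rho2E : forall x y, rho2 [tuple x; y] = 1 - T2 (x - y)).
Context (T2_le : forall v, `|T2 v| <= M).
Local Notation mu := (@lebesgue_measure R).
Let r v := 1 - T2 v.

Lemma even_integrable (g : R -> R) (A : R) : (forall v, g (- v) = g v) ->
  mu.-integrable `[0, A] (EFin \o g) -> mu.-integrable `[- A, 0] (EFin \o g).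
Proof.
move=> gN /(integrable_reflect 0); rewrite !sub0r oppr0.
by rewrite (_ : (fun x => g (0 - x)) = g)//; apply/funext => x; rewrite sub0r gN.
Qed.

Lemma Rintegral_even (g : R -> R) (A : R) : (forall v, g (- v) = g v) ->
  mu.-integrable `[0, A] (EFin \o g) ->
  \int[mu]_(v in `[- A, 0]) g v = \int[mu]_(v in `[0, A]) g v.
Proof.
move=> gN gi; rewrite -(Rintegral_reflect 0 gi) !sub0r oppr0.
by apply: eq_Rintegral => x _; rewrite sub0r gN.
Qed.

Lemma ge0_Rintegral_density_sym (g : R -> R) (A : R) :
  measurable_fun [set: R] g -> (forall v, 0 <= g v) -> (forall v, g (- v) = g v) ->
  \int[mu]_(v in `[- A, 0]) (g v * r v) = \int[mu]_(v in `[0, A]) (g v * r v).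
Proof.
move=> mg g0 gN; rewrite /Rintegral; congr fine.
rewrite -(integral_pair_density_sym corr2 (r := r) rho2E)// integral_itv_bndo_bndc//.
apply/measurable_EFinP; apply: measurable_funTS; apply: measurable_funM => //.
exact: (@measurable_pair_density _ _ _ _ _ _ r corr2 rho2E).
Qed.

(** Symmetry of the density is known against nonnegative even weights. Here g = q - p with p = |g|
    and q = |g| + g of that kind, and T2 g = g - (q r - p r). *)
Lemma Rintegral_T2_sym (g : R -> R) (A : R) : measurable_fun [set: R] g ->
  (forall v, g (- v) = g v) -> mu.-integrable `[0, A] (EFin \o g) ->
  \int[mu]_(v in `[- A, 0]) (T2 v * g v) = \int[mu]_(v in `[0, A]) (T2 v * g v).
Proof.
move=> mg gN gi; pose p v := `|g v|; pose q v := `|g v| + g v.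
have pN v : p (- v) = p v by rewrite /p gN.
have qN v : q (- v) = q v by rewrite /q gN.
have mp : measurable_fun [set: R] p by exact: measurableT_comp.
have mq : measurable_fun [set: R] q by exact: measurable_funD.
have p0 v : 0 <= p v by exact: normr_ge0.
have q0 v : 0 <= q v by rewrite /q; have := ler_norm (- g v); rewrite normrN; lra.
have pi_ : mu.-integrable `[0, A] (EFin \o p) by exact: integrable_norm.
have qi : mu.-integrable `[0, A] (EFin \o q) by have := integrableD _ pi_ gi; exact.
have dens (h : R -> R) (u v : R) : mu.-integrable `[u, v] (EFin \o h) ->
    mu.-integrable `[u, v] (EFin \o (fun v => h v * r v)).
  exact: (pair_density_mul corr2 rho2E T2_le).
have E (u v : R) : mu.-integrable `[u, v] (EFin \o g) ->
    \int[mu]_(v in `[u, v]) (T2 v * g v) = \int[mu]_(v in `[u, v]) g v -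
    (\int[mu]_(v in `[u, v]) (q v * r v) - \int[mu]_(v in `[u, v]) (p v * r v)).
  move=> hi; have hp : mu.-integrable `[u, v] (EFin \o p) by exact: integrable_norm.
  have hq : mu.-integrable `[u, v] (EFin \o q) by have := integrableD _ hp hi; exact.
  have hpr := dens _ _ _ hp; have hqr := dens _ _ _ hq.
  have hd : mu.-integrable `[u, v] (EFin \o (fun v => q v * r v - p v * r v)).
    by have := integrableB _ hqr hpr; exact.
  rewrite -(RintegralB _ hqr hpr)// -(RintegralB _ hi hd)//.
  by apply: eq_Rintegral => x _; rewrite /q /p /r; ring.
rewrite E; last exact: even_integrable.
by rewrite E// Rintegral_even// !ge0_Rintegral_density_sym.
Qed.

(** Reflection turns the integral over [[0, a - x]] into the one over [[x, a]], so for every x the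
    inner sum is the integral over a full period, which vanishes. *)
Lemma triangle_logsin (a : R) : 0 < a -> triangle_integral (logsin a) a = 0.
Proof.
move=> a0; have li := integrable_logsin a0.
rewrite /triangle_integral (eq_Rintegral _ (g := fun=> 0)).
  by rewrite Rintegral_cst// mul0r.
move=> x; rewrite inE/= in_itv/= => /andP[x0 xa].
have lix : mu.-integrable `[x, a] (EFin \o logsin a) by apply: integrable_subitv li.
rewrite -[RHS](Rintegral_logsin a0) (Rintegral_itv_split x0 xa li); congr (_ + _).
rewrite -(Rintegral_reflect a lix) subrr.
by apply: eq_Rintegral => v _; rewrite logsin_reflect.
Qed.

(** The constant 1 in the density [1 - T2] contributes nothing by [triangle_logsin]; the minus sign
    of the energy cancels the one in front of [T2]. *)
Lemma expected_energy (N : nat) : (0 < N)%N ->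
  ('E_P[renormalized_energy N \o X] =
   (triangle_integral (fun v => T2 v * logsin N%:R v) N%:R / N%:R + ln N%:R)%:E)%E.
Proof.
move=> N0; have a0 : 0 < N%:R :> R by rewrite ltr0n.
have li := integrable_logsin a0.
have ln2 : 0 <= ln 2 :> R by rewrite ln_ge0// ler1n.
have ri : mu.-integrable `[0, N%:R] (EFin \o r).
  have := integrableB _ (integrable_cst_itv 0 N%:R 1) (integrable_T2 corr2 rho2E T2_le 0 N%:R).
  exact.
have lri := pair_density_mul corr2 rho2E T2_le (measurable_itv _) li.
have [Si SE] := @pair_sum_expectation _ _ _ _ _ _ r processX corr2 rho2E (logsin N%:R)
  (ln 2) N%:R a0 ln2 (measurable_logsin _) (logsin_le _) (logsinN _)
  (@continuous_logsin _ _) ri lri.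
have triE : triangle_integral (fun v => logsin N%:R v * r v) N%:R =
    - triangle_integral (fun v => T2 v * logsin N%:R v) N%:R.
  rewrite (_ : (fun v => _) = (fun v => logsin N%:R v - T2 v * logsin N%:R v)); last first.
    by apply/funext => v; rewrite /r; ring.
  have ti := integrable_T2_mul corr2 rho2E T2_le (measurable_itv _) li.
  by rewrite (triangle_integralB (ltW a0) li ti) triangle_logsin// sub0r.
have SiZ : P.-integrable [set: T]
    (EFin \o (fun w => - N%:R^-1 * pair_sum (X := X) (logsin N%:R) N%:R w)).
  by have := integrableZl _ (- N%:R^-1) Si; exact.
have cE : (\int[P]_w (ln (N%:R : R))%:E = (ln N%:R)%:E)%E.
  by rewrite integral_cst//= probability_setT mule1.
have ci : P.-integrable [set: T] (EFin \o (fun=> ln (N%:R : R))).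
  exact: finite_measure_integrable_cst.
rewrite unlock.
transitivity (\int[P]_w ((- N%:R^-1 * pair_sum (X := X) (logsin N%:R) N%:R w)%:E +
    (ln (N%:R : R))%:E))%E.
  by [].
rewrite [LHS](integralD_EFin measurableT SiZ ci) cE.
transitivity ((- N%:R^-1)%:E * \int[P]_w (pair_sum (X := X) (logsin N%:R) N%:R w)%:E +
    (ln (N%:R : R))%:E)%E.
  by congr (_ + _)%E; rewrite -(integralZl measurableT Si).
by rewrite SE triE -EFinM -EFinD mulrNN mulrC.
Qed.

End energy.

(** * Asymptotics *)

Section asymptotics.
Context {R : realType} {T2 : R -> R} {M : R}.
Context (mT2 : measurable_fun [set: R] T2).
Context (T2_le : forall v, `|T2 v| <= M).
Local Notation mu := (@lebesgue_measure R).

Definition density_primitive (x : R) : R := \int[mu]_(v in `[0, x]) T2 v.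
Definition log_primitive (x : R) : R := \int[mu]_(v in `[0, x]) (T2 v * ln `|v|).

Let integrable_mul (D : set R) (g : R -> R) : measurable D ->
  mu.-integrable D (EFin \o g) -> mu.-integrable D (EFin \o (fun v => T2 v * g v)).
Proof.
by move=> mD; apply: (integrable_bounded_mul (M := M)) => //; exact: measurable_funTS.
Qed.

Let iT (u v : R) : mu.-integrable `[u, v] (EFin \o T2).
Proof. exact: integrable_bounded_itv mT2 T2_le. Qed.

Let M0 : 0 <= M. Proof. exact: le_trans (T2_le 0). Qed.

Lemma integrable_ln_norm (u : R) : mu.-integrable `[0, u] (EFin \o (fun v : R => ln `|v|)).
Proof.
apply: (@le_integrable _ _ _ mu _ _ _ (EFin \o (fun v => `|ln v|))) => //.
- apply/measurable_EFinP; apply: measurable_funTS.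
  exact: measurableT_comp.
- move=> v /=; rewrite in_itv/= => /andP[v0 _].
  by rewrite lee_fin normr_id (ger0_norm v0).
- exact: integrable_absln.
Qed.

Lemma integrable_T2_ln (u : R) :
  mu.-integrable `[0, u] (EFin \o (fun v => T2 v * ln `|v|)).
Proof. by apply: integrable_mul => //; exact: integrable_ln_norm. Qed.

(** The bound of [Rintegral_logsin_half] has four terms, each at most [al * ln a] since ln 2 <= 1 <=
    ln a, 1 <= al and ln al <= ln a. *)
Lemma Rintegral_logsin_scale_le (a al : R) (a0 : 0 < a) (lna : 1 <= ln a)
    (al1 : 1 <= al) (al4 : al <= a / 4) :
  \int[mu]_(v in `[0, al]) `|logsin a v| <= 4 * (al * ln a).
Proof.
have h : 1 <= al <= a / 2 by apply/andP; split; lra.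
apply: le_trans (Rintegral_logsin_half a0 h) _.
have l2 : ln 2 <= 1 :> R by have := @le_ln1Dx R 1; rewrite (_ : 1 + 1 = 2) ?addr1//; apply; lra.
rewrite (ger0_norm (_ : 0 <= ln a)); last lra.
have : 0 <= ln al <= ln a by rewrite ln_ge0//= ler_ln ?posrE//; lra.
nra.
Qed.

Lemma Rintegral_weight_logsin_le (a u v K : R) : 0 < a -> 0 <= u -> v <= a ->
  \int[mu]_(x in `[u, v]) `|logsin a x| <= K ->
  \int[mu]_(x in `[u, v]) `|T2 x * logsin a x| <= M * K.
Proof.
move=> a0 u0 va H.
have li : mu.-integrable `[u, v] (EFin \o logsin a).
  by apply: integrable_subitv (integrable_logsin a0).
apply: (@le_trans _ _ (\int[mu]_(x in `[u, v]) (M * `|logsin a x|))).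
  apply: le_Rintegral => //.
  - by apply: integrable_norm; exact: integrable_mul.
  - by have := integrableZl _ M (integrable_norm li); exact.
  - by move=> x _; rewrite normrM ler_wpM2r.
by rewrite RintegralZl//; [rewrite ler_wpM2l|exact: integrable_norm].
Qed.

Lemma logsin_primitive_approx (a al : R) (a0 : 0 < a) (lna : 1 <= ln a)
    (al1 : 1 <= al) (al4 : al <= a / 4) :
  `|\int[mu]_(v in `[0, al]) (T2 v * logsin a v) -
    (log_primitive al + ln (2 * pi / a) * density_primitive al)| <=
  M * (pi * al / a) ^+ 2 * al.
Proof.
have p0 := pi_gt0 R.
have p4 : pi < 4 :> R by have := pihalf_lt2 R; lra.
have li : mu.-integrable `[0, al] (EFin \o logsin a).
  by apply: integrable_subitv (integrable_logsin a0); lra.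
have i1 := integrable_mul (measurable_itv _) li.
have i2 := integrable_T2_ln al.
have i3 : mu.-integrable `[0, al] (EFin \o (fun v => ln (2 * pi / a) * T2 v)).
  by have := integrableZl _ (ln (2 * pi / a)) (iT 0 al); exact.
have i23 : mu.-integrable `[0, al] (EFin \o (fun v => T2 v * ln `|v| + ln (2 * pi / a) * T2 v)).
  by have := integrableD _ i2 i3; exact.
have i123 : mu.-integrable `[0, al] (EFin \o (fun v => T2 v * logsin a v -
    (T2 v * ln `|v| + ln (2 * pi / a) * T2 v))).
  by have := integrableB _ i1 i23; exact.
rewrite /log_primitive /density_primitive -RintegralZl// -(RintegralD _ i2 i3)//.
(* The point 0 is removed: there both logarithms take the default value 0 and the pointwise estimate
   fails. *)
rewrite -(RintegralB _ i1 i23)// -Rintegral_itv_obnd_cbnd; last first.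
  by apply: integrableS i123 => //; apply: subset_itv; rewrite bnd_simp.
apply: (@le_trans _ _ (\int[mu]_(v in `]0, al]) (M * (pi * al / a) ^+ 2))).
  apply: norm_Rintegral_le => //.
  - by apply: integrableS i123 => //; apply: subset_itv; rewrite bnd_simp.
  - have := integrable_cst_itv 0 al (M * (pi * al / a) ^+ 2).
    by apply: integrableS => //; apply: subset_itv; rewrite bnd_simp.
  move=> v /=; rewrite in_itv/= => /andP[v0 val].
  have -> : T2 v * logsin a v - (T2 v * ln `|v| + ln (2 * pi / a) * T2 v) =
      T2 v * (logsin a v - (ln v + ln (2 * pi / a))).
    by rewrite gtr0_norm//; ring.
  rewrite normrM ler_pM//.
  have pv : pi * v / a <= pi * al / a by rewrite ler_pM2r ?invr_gt0// ler_pM2l.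
  have pal1 : pi * al / a <= 1 by rewrite ler_pdivrMr//; nra.
  apply: (le_trans (logsin_approx a0 v0 (le_trans pv pal1))).
  by rewrite ler_sqr ?nnegrE// divr_ge0 ?mulr_ge0// ltW//; lra.
rewrite Rintegral_cst//= lebesgue_measure_itv/= lte_fin ifT; last lra.
by rewrite /= oppr0 addr0.
Qed.

(** With q = al^2 ln a / a, the end pieces have B = 4 M al ln a, so [triangle_estimate] costs 2e +
    (16 M + 4e) q. Replacing [logsin] near 0 costs at most 16 M q, as pi^2 < 16, and it occurs
    twice. Writing ln(2 pi / a) = ln(2 pi) - ln a collects the factor 1 - 2 Psi of ln a. *)
Lemma energy_estimate (a al : R) (a0 : 0 < a) (lna : 1 <= ln a)
    (al1 : 1 <= al) (al4 : al <= a / 4) (e : R) :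
  (forall A, al <= A <= a - al ->
    `|\int[mu]_(v in `[al, A]) (T2 v * logsin a v)| <= e) ->
  al ^+ 2 * ln a / a <= 1 ->
  `|triangle_integral (fun v => T2 v * logsin a v) a / a + ln a -
    (ln a * (1 - 2 * density_primitive al) + 2 * ln (2 * pi) * density_primitive al +
     2 * log_primitive al)| <=
  2 * e + (16 * M + 4 * e + 32 * M) * (al ^+ 2 * ln a / a).
Proof.
move=> mid q1; have p0 := pi_gt0 R.
have p4 : pi < 4 :> R by have := pihalf_lt2 R; lra.
have li := integrable_logsin a0.
have ti := integrable_mul (measurable_itv _) li.
have e0 : 0 <= e by apply: le_trans (mid al _); rewrite ?normr_ge0// lexx/=; lra.
have lhalf : mu.-integrable `[0, al] (EFin \o (fun v => `|logsin a v|)).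
  by apply: integrable_norm; apply: integrable_subitv li; lra.
have B1 : \int[mu]_(v in `[0, al]) `|T2 v * logsin a v| <= M * (4 * (al * ln a)).
  apply: Rintegral_weight_logsin_le => //; first lra.
  exact: Rintegral_logsin_scale_le.
have B2 : \int[mu]_(v in `[a - al, a]) `|T2 v * logsin a v| <= M * (4 * (al * ln a)).
  apply: Rintegral_weight_logsin_le => //; first lra.
  apply: le_trans _ (Rintegral_logsin_scale_le a0 lna al1 al4).
  rewrite -(Rintegral_reflect a lhalf) subr0.
  rewrite le_eqVlt; apply/orP; left; apply/eqP.
  by apply: eq_Rintegral => x _; rewrite logsin_reflect.
have al0 : 0 <= al by lra.
have ala : al <= a - al by lra.
have := triangle_estimate a0 al0 ala ti mid B1 B2.
have := logsin_primitive_approx a0 lna al1 al4.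
have -> : ln (2 * pi / a) = ln (2 * pi) - ln a by rewrite ln_div ?posrE// mulr_gt0.
set t := triangle_integral _ _ / a; set I := (\int[mu]_(v in `[0, al]) (T2 v * logsin a v)).
set q := al ^+ 2 * ln a / a.
have qE : al * (al * ln a) / a = q by rewrite /q; ring.
have ala0 : 0 <= al / a by rewrite divr_ge0// ltW.
have q0 : 0 <= q by rewrite /q !mulr_ge0 ?sqr_ge0 ?invr_ge0//; [lra|exact: ltW].
have h1 : al / a <= q.
  rewrite /q ler_pM2r ?invr_gt0// expr2; nra.
have h2 : M * (pi * al / a) ^+ 2 * al <= 16 * M * q.
  have -> : M * (pi * al / a) ^+ 2 * al = M * (pi ^+ 2 * ((al / a) * (al * al / a))).
    by field; rewrite gt_eqF.
  have h3 : al * al / a <= q by rewrite /q ler_pM2r ?invr_gt0// expr2; nra.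
  have h4 : (al / a) * (al * al / a) <= q.
    apply: (@le_trans _ _ (1 * q)); last by rewrite mul1r.
    by apply: ler_pM => //; [rewrite divr_ge0 ?mulr_ge0// ltW|exact: le_trans h1 _].
  rewrite (_ : 16 * M * q = M * (16 * q)); last by ring.
  rewrite ler_wpM2l//.
  have h5 : 0 <= (al / a) * (al * al / a) by rewrite mulr_ge0// divr_ge0 ?mulr_ge0// ltW.
  apply: ler_pM => //; first exact: sqr_ge0.
  by rewrite (_ : 16 = 4 ^+ 2); [rewrite ler_sqr ?nnegrE; lra|ring].
have h6 : 4 * (M * (4 * (al * ln a)) + e) * (al / a) <= (16 * M + 4 * e) * q.
  have -> : 4 * (M * (4 * (al * ln a)) + e) * (al / a) =
      16 * M * (al * (al * ln a) / a) + 4 * e * (al / a) by ring.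
  have h7 : 4 * e * (al / a) <= 4 * e * q by rewrite ler_wpM2l// mulr_ge0.
  by rewrite qE; lra.
rewrite !ler_norml => /andP[? ?] /andP[? ?]. apply/andP; split; lra.
Qed.

(* phi = ln / (- logsin a) is nondecreasing and at most 2 up to sqrt a. *)
Lemma log_primitive_near (a al : R) (a0 : 0 < a) (lna : 1 <= ln a)
    (al1 : 1 <= al) (al4 : al <= a / 4)
    (lnbig : 4 * ln (2 * pi) <= ln a) (e A : R) :
  (forall x, al <= x <= a - al ->
    `|\int[mu]_(v in `[al, x]) (T2 v * logsin a v)| <= e) ->
  al <= A -> A ^+ 2 <= a -> A <= a - al -> A <= a / 8 ->
  `|log_primitive A - log_primitive al| <= 4 * e.
Proof.
move=> mid alA A2 Aa A8; have p0 := pi_gt0 R; have p2 := pi_ge2 R.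
have p4 : pi < 4 :> R by have := pihalf_lt2 R; lra.
have al0 : 0 <= al by lra.
rewrite /log_primitive (Rintegral_itv_split al0 alA (integrable_T2_ln A)) addrC addKr.
have li : mu.-integrable `[al, A] (EFin \o logsin a).
  by apply: integrable_subitv (integrable_logsin a0); lra.
have ti := integrable_mul (measurable_itv _) li.
have hi : mu.-integrable `[al, A] (EFin \o (fun v => -1 * (T2 v * logsin a v))).
  by have := integrableZl _ (-1) ti; exact.
(* The quotient ln v / (- logsin a v) wherever the denominator is positive. With the inverse written
   as exp(- ln), measurability on the whole line follows by composition. *)
pose phi v := ln v * expR (- ln (- logsin a v)).
have lnA : 2 * ln A <= ln a.
  have A0 : 0 < A by lra.
  by rewrite mulr_natl -lnXn// ler_ln ?posrE// exprn_gt0.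
(* Since ln v <= (ln a) / 2 and ln(2 pi) <= (ln a) / 4, [logsin_le_ln] gives - logsin a v >= (ln a)
   / 4 > 0. Hence the quotient is at most 2. *)
have L v : al <= v <= A ->
    [/\ 0 <= ln v, ln v <= 2 * - logsin a v & 0 < - logsin a v].
  move=> /andP[alv vA]; have v0 : 0 < v < a by apply/andP; split; lra.
  have h1 := logsin_le_ln v0.
  have h2 : ln v <= ln A by rewrite ler_ln ?posrE; lra.
  have h3 : 0 <= ln v by apply: ln_ge0; lra.
  by split; lra.
have mono u v : al <= u -> u <= v -> v <= A -> logsin a u <= logsin a v.
  by move=> alu uv vA; apply: logsin_mono; lra.
have phiE v : al <= v <= A -> phi v * (- logsin a v) = ln v.
  by case/L => _ _ v0; rewrite /phi expRN lnK ?posrE// divfK// gt_eqF.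
have -> : \int[mu]_(v in `[al, A]) (T2 v * ln `|v|) =
    \int[mu]_(v in `[al, A]) (phi v * (-1 * (T2 v * logsin a v))).
  apply: eq_Rintegral => v; rewrite inE/= in_itv/= => vA; rewrite ger0_norm; last first.
    by case/andP: vA; lra.
  by rewrite -(phiE v vA); ring.
(* The factor 2 is the bound on [phi]; 2e bounds a tail over [s, A], which is a difference of two
   integrals starting at al. *)
rewrite (_ : 4 * e = 2 * (2 * e)); last by ring.
apply: bonnet => //.
- apply: measurable_funM => //; apply: measurableT_comp => //.
  apply: measurableT_comp => //; apply: measurableT_comp => //.
  by apply: measurableT_comp => //; exact: measurable_logsin.
- move=> v vA; have [h1 h2 h3] := L v vA.
  by rewrite mulr_ge0 ?expR_ge0//= -(ler_pM2r h3) -/(phi v) phiE.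
- move=> u v alu uv vA.
  have uA : al <= u <= A by apply/andP; split; lra.
  have vA' : al <= v <= A by apply/andP; split; lra.
  have [h1 h2 h3] := L u uA; have [_ _ h4] := L v vA'.
  rewrite ler_pM ?expR_ge0//.
    by rewrite ler_ln ?posrE; lra.
  by rewrite ler_expR lerN2 ler_ln ?posrE// lerN2; exact: mono.
- move=> s /andP[als sA].
  rewrite RintegralZl//; last by apply: integrable_subitv ti; lra.
  rewrite mulN1r normrN.
  have := Rintegral_itv_split als sA ti.
  have := mid s; have := mid A; rewrite als alA Aa (le_trans sA Aa) => /(_ isT) + /(_ isT).
  move: (Rintegral _ _ _) (Rintegral _ _ _) (Rintegral _ _ _) => x y z.
  rewrite !ler_norml => /andP[? ?] /andP[? ?] ?; apply/andP; split; lra.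
Qed.

End asymptotics.

(** * Improper integrals whose two halves agree *)

Section improper_even.
Context {R : realType}.
Local Notation mu := (@lebesgue_measure R).

Lemma improper_even (f : R -> R) (J : R) :
  (forall A, 0 <= A -> \int[mu]_(v in `[- A, 0]) f v = \int[mu]_(v in `[0, A]) f v) ->
  improper_integral f J -> \int[mu]_(v in `[0, A]) f v @[A --> +oo] --> J / 2.
Proof.
move=> sym [_ [lm [lr [cm cr ->]]]].
suff -> : lm = lr by rewrite (_ : (lr + lr) / 2 = lr)//; field.
have cm' : \int[mu]_(v in `[- A, 0]) f v @[A --> +oo] --> lr.
  apply: cvg_trans cr; apply: near_eq_cvg.
  by near=> A; apply/esym/sym.
by rewrite -(cvg_lim (@Rhausdorff R) cm) (cvg_lim (@Rhausdorff R) cm').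
Unshelve. all: by end_near. Qed.

Lemma even_improper (f : R -> R) (l : R) :
  (forall a b, mu.-integrable `[a, b] (EFin \o f)) ->
  (forall A, 0 <= A -> \int[mu]_(v in `[- A, 0]) f v = \int[mu]_(v in `[0, A]) f v) ->
  \int[mu]_(v in `[0, A]) f v @[A --> +oo] --> l ->
  improper_integral f (l + l).
Proof.
move=> fi sym cl; split => //; exists l, l; split => //.
apply: cvg_trans cl; apply: near_eq_cvg.
by near=> A; apply/esym/sym.
Unshelve. all: by end_near. Qed.

End improper_even.

(** * Limits along the scales [alpha N] *)

Section limits.
Context {R : realType} {T2 : R -> R} {M : R} {alpha : nat -> R} {eps : R}.
Context (mT2 : measurable_fun [set: R] T2).
Context (T2_le : forall v, `|T2 v| <= M).
Context (eps_gt0 : 0 < eps).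
Context (alpha_gt0 : \forall N \near \oo, 0 < alpha N).
Context (ln_alpha : (fun N : nat => ln (N%:R : R)) =o_\oo alpha).
Context (alpha_pow : alpha =o_\oo (fun N : nat => (N%:R : R) `^ (2^-1 - eps))).
Local Notation mu := (@lebesgue_measure R).
Context (T2_log_sin : forall e : R, 0 < e -> \forall N \near \oo,
  forall A : R, alpha N <= A <= N%:R - alpha N ->
    `|\int[mu]_(v in `[alpha N, A]) (T2 v * logsin N%:R v)| < e).

Lemma cvg_ln_nat : ln (N%:R : R) @[N --> \oo] --> +oo.
Proof.
apply/cvgryPge => A; near=> N.
have AN : expR A <= N%:R.
  by near: N; exact: (nbhs_infty_ger (expR A)).
rewrite -[A]expRK ler_ln ?posrE ?expR_gt0//.
by apply: lt_le_trans AN; exact: expR_gt0.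
Unshelve. all: by end_near. Qed.

Lemma cvg_alpha : alpha N @[N --> \oo] --> +oo.
Proof.
apply/cvgryPge => A; near=> N.
have h1 : A <= ln N%:R.
  by near: N; move/cvgryPge : cvg_ln_nat; exact.
have h2 : `|ln (N%:R : R)| <= 1 * `|alpha N|.
  by near: N; have /eqoP/(_ 1 ltr01) := ln_alpha.
have h3 : 0 < alpha N by near: N.
move: h2; rewrite mul1r (gtr0_norm h3); have := ler_norm (ln (N%:R : R)); lra.
Unshelve. all: by end_near. Qed.

Let q (N : nat) : R := alpha N ^+ 2 * ln N%:R / N%:R.

(** Eventually alpha_N^2 <= s^2 N^(1 - 2 eps) for any s > 0, and 2 eps ln N = ln(N^(2 eps)) <= N^(2
    eps) absorbs the logarithm. *)
Lemma cvg_alpha_sqr : q N @[N --> \oo] --> 0.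
Proof.
apply/cvgrPdist_le => e e0.
(* Chosen so that s^2 / (2 eps) = e, the factor 2 eps being the one spent on ln N. *)
pose s := Num.sqrt (e * (2 * eps)).
have s0 : 0 < s by rewrite sqrtr_gt0 !mulr_gt0.
have sE : s ^+ 2 = e * (2 * eps) by rewrite sqr_sqrtr// !mulr_ge0// ltW.
near=> N.
have N0 : 0 < (N%:R : R) by near: N; exact: (nbhs_infty_gtr (0 : R)).
have h2 : `|alpha N| <= s * `|(N%:R : R) `^ (2^-1 - eps)|.
  by near: N; have /eqoP/(_ s s0) := alpha_pow.
have l0 : 0 <= ln (N%:R : R).
  by near: N; move/cvgryPge : cvg_ln_nat; exact.
have p0 := powR_gt0 (2^-1 - eps) N0.
have p1 := powR_gt0 (2 * eps) N0.
have lnle : 2 * eps * ln (N%:R : R) <= (N%:R : R) `^ (2 * eps).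
  by rewrite -ln_powR; apply/ltW/ln_sublinear.
have pE : ((N%:R : R) `^ (2^-1 - eps)) ^+ 2 * (N%:R : R) `^ (2 * eps) = N%:R.
  rewrite -powR_mulrn ?ltW// -powRrM -powRD; last first.
    by apply/implyP => _; rewrite gt_eqF.
  rewrite (_ : (2^-1 - eps) * 2 + 2 * eps = 1); last by field.
  by rewrite powRr1// ltW.
move: h2; rewrite (gtr0_norm p0); move: p0 p1 lnle pE.
move: (_ `^ _) (_ `^ _) => y x x0 y0 lnle xyN axs.
have a2 : alpha N ^+ 2 <= (s * x) ^+ 2.
  have sx : 0 <= s * x by apply: mulr_ge0; exact: ltW.
  by rewrite -[alpha N ^+ 2]real_normK ?num_real// ler_sqr ?nnegrE.
have q0 : 0 <= q N.
  by apply: divr_ge0; [apply: mulr_ge0 => //; exact: sqr_ge0|exact: ltW].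
rewrite sub0r normrN ger0_norm// /q ler_pdivrMr//.
apply: le_trans (ler_wpM2r l0 a2) _.
rewrite exprMn sE -[X in _ <= _ * X]xyN.
have x20 : 0 <= x ^+ 2 by exact: sqr_ge0.
rewrite (_ : e * (2 * eps) * x ^+ 2 * ln N%:R = e * x ^+ 2 * (2 * eps * ln N%:R)); last by ring.
by rewrite [leRHS]mulrA ler_wpM2l// mulr_ge0// ltW.
Unshelve. all: by end_near. Qed.

(** The bound 1 / 4 on [q N] gives alpha_N^2 <= N / 4 because ln N >= 1. This yields alpha_N <= N /
    4, and later alpha_N <= A when N is about A^2. *)
Let good (N : nat) := [/\ 0 < (N%:R : R), 1 <= ln (N%:R : R), 1 <= alpha N,
  alpha N <= N%:R / 4 & q N <= 1 / 4].

Let near_good : \forall N \near \oo, good N.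
Proof.
near=> N.
have N0 : 0 < (N%:R : R) by near: N; exact: (nbhs_infty_gtr (0 : R)).
have l1 : 1 <= ln (N%:R : R).
  by near: N; move/cvgryPge : cvg_ln_nat; exact.
have a1 : 1 <= alpha N.
  by near: N; move/cvgryPge : cvg_alpha; exact.
have q4 : q N <= 1 / 4.
  near: N; move/cvgrPdist_le : cvg_alpha_sqr => /(_ (1 / 4)).
  rewrite divr_gt0// => /(_ isT); apply: filterS => N.
  by rewrite sub0r normrN; apply: le_trans; exact: ler_norm.
split => //; move: q4; rewrite /q !ler_pdivrMr//.
by rewrite expr2; nra.
Unshelve. all: by end_near. Qed.

Let W (N : nat) : R :=
  triangle_integral (fun v => T2 v * logsin N%:R v) N%:R / N%:R + ln N%:R.

Lemma energy_asymptotics :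
  W N - (ln N%:R * (1 - 2 * density_primitive (T2 := T2) (alpha N)) +
    2 * ln (2 * pi) * density_primitive (T2 := T2) (alpha N) +
    2 * log_primitive (T2 := T2) (alpha N)) @[N --> \oo] --> 0.
Proof.
have M0 : 0 <= M by apply: le_trans (T2_le 0).
(* The error is 2e plus C q, and q is made at most e / C: 3e <= h in all. *)
apply/cvgrPdist_le => h h0; pose e := h / 4; have e0 : 0 < e by rewrite divr_gt0.
pose C := 16 * M + 4 * e + 32 * M.
have C0 : 0 < C by rewrite /C; lra.
near=> N; rewrite sub0r normrN.
have [N0 l1 a1 a4 q4] : good N by near: N.
have mid A : alpha N <= A <= N%:R - alpha N ->
    `|\int[mu]_(v in `[alpha N, A]) (T2 v * logsin N%:R v)| <= e.
  move=> AA; apply/ltW; move: A AA; near: N; exact: T2_log_sin.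
have q1 : q N <= 1 by lra.
apply: le_trans (energy_estimate mT2 T2_le N0 l1 a1 a4 mid q1) _.
have qs : q N <= e / C.
  near: N; move/cvgrPdist_le : cvg_alpha_sqr => /(_ (e / C)).
  rewrite divr_gt0// => /(_ isT); apply: filterS => N.
  by rewrite sub0r normrN; apply: le_trans; exact: ler_norm.
have : C * q N <= e by rewrite mulrC -ler_pdivlMr.
rewrite -/C -/(q N) /e; lra.
Unshelve. all: by end_near. Qed.

(** The sequence [alpha N] may skip large ranges, so its limit alone does not determine that of the
    primitive. Each large A is compared with [alpha N] for an N adapted to A. *)
Lemma cvg_log_primitive (l : R) :
  log_primitive (T2 := T2) (alpha N) @[N --> \oo] --> l ->
  log_primitive (T2 := T2) A @[A --> +oo] --> l.
Proof.
move=> cl; apply/cvgrPdist_le => h h0; pose e := h / 8.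
have e0 : 0 < e by rewrite divr_gt0.
have [N1 _ HN] : \forall N \near \oo,
    [/\ good N, 4 * ln (2 * pi) <= ln (N%:R : R),
      `|l - log_primitive (T2 := T2) (alpha N)| <= h / 2 &
      forall A, alpha N <= A <= N%:R - alpha N ->
        `|\int[mu]_(v in `[alpha N, A]) (T2 v * logsin N%:R v)| <= e].
  near=> N; split.
  - by near: N; exact: near_good.
  - by near: N; move/cvgryPge : cvg_ln_nat; exact.
  - by near: N; move/cvgrPdist_le : cl; apply; rewrite divr_gt0.
  - move=> A AA; apply/ltW; move: A AA; near: N; exact: T2_log_sin.
near=> A.
have A8 : 8 <= A by near: A; exact: nbhs_pinfty_ge.
have AN : N1%:R <= A by near: A; exact: nbhs_pinfty_ge.
(* Now A^2 <= N <= A^2 + 1, so A is at most sqrt N and still above alpha_N, as alpha_N^2 <= N / 4.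
   For A >= 8 the remaining bounds A <= N / 8 and A <= N - alpha_N also hold. *)
pose N := (Num.truncn (A ^+ 2)).+1.
have A20 : 0 <= A ^+ 2 by exact: sqr_ge0.
have /andP[NA1 NA2] := truncn_itv A20.
have NE : (N%:R : R) <= A ^+ 2 + 1 by rewrite /N -natr1; lra.
have A2A : A ^+ 2 >= 8 * A by rewrite expr2; nra.
have N1N : (N1 <= N)%N.
  by rewrite -(ler_nat R); move: NA2; rewrite -/N; lra.
have [[N0 l1 a1 a4 q4] lb cN mid] := HN N N1N.
have alA : alpha N <= A.
  rewrite -ler_sqr ?nnegrE; [|lra|lra].
  move: q4; rewrite /q ler_pdivrMr// => q4.
  have : alpha N ^+ 2 <= alpha N ^+ 2 * ln N%:R by rewrite ler_peMr// sqr_ge0.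
  lra.
have NA2' : A ^+ 2 <= N%:R by exact: ltW.
have h1 : A <= N%:R - alpha N by lra.
have h2 : A <= N%:R / 8 by lra.
have := log_primitive_near mT2 T2_le N0 l1 a1 a4 lb mid alA NA2' h1 h2.
move: cN; rewrite !ler_norml /e => /andP[? ?] /andP[? ?]; apply/andP; split; lra.
Unshelve. all: by end_near. Qed.

End limits.

Lemma integrable_even_itv (R : realType) (f : R -> R) :
  (forall A, (@lebesgue_measure R).-integrable `[- A, 0] (EFin \o f)) ->
  (forall A, (@lebesgue_measure R).-integrable `[0, A] (EFin \o f)) ->
  forall a b, (@lebesgue_measure R).-integrable `[a, b] (EFin \o f).
Proof.
move=> fl fr a b; pose K := `|a| + `|b|.
have := normr_ge0 a; have := normr_ge0 b; have := ler_norm b; have := ler_norm (- a).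
rewrite normrN => h1 h2 h3 h4.
have K0 : 0 <= K by exact: addr_ge0.
apply: (@integrable_subitv _ (- K) K); [rewrite /K; lra|rewrite /K; lra|].
by apply: (@integrable_itv_join _ _ 0) => //; rewrite oppr_le0.
Qed.

Theorem theorem1 (R : realType) (d : measure_display) (T : measurableType d)
    (P : probability T R) (X : T -> config R)
    (rho : forall k : nat, k.-tuple R -> R) (T2 : R -> R)
    (alpha : nat -> R) (eps : R)
    (X_process : simple_point_process X)
    (X_invariant : translation_invariant P X)
    (X_rho : forall k : nat, (0 < k)%N -> correlation_function P X (rho k))
    (rho1 : forall x : R, rho 1%N [tuple x] = 1)
    (rho2 : forall x y : R, rho 2%N [tuple x; y] = 1 - T2 (x - y))
    (T2_bounded : exists M : R, forall v : R, `|T2 v| <= M)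
    (eps_gt0 : 0 < eps)
    (alpha_gt0 : \forall N \near \oo, 0 < alpha N)
    (ln_alpha : (fun N : nat => ln (N%:R : R)) =o_\oo alpha)
    (alpha_pow : alpha =o_\oo (fun N : nat => (N%:R : R) `^ (2^-1 - eps)))
    (T2_log_sin : forall e : R, 0 < e -> \forall N \near \oo,
       forall A : R, alpha N <= A <= N%:R - alpha N ->
         `|\int[lebesgue_measure]_(v in `[alpha N, A])
             (T2 v * ln `|2 * sin (pi * v / N%:R)|)| < e) :
  (* (a) *)
  (forall c : R,
     improper_converges (fun v => T2 v * ln `|v|) ->
     improper_integral T2 c -> c != 1 ->
     ('E_P[renormalized_energy N \o X])%E @[N --> \oo] --> +oo%E) /\
  (* (b) *)
  (improper_integral T2 1 ->
   (fun N : nat =>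
      1 - \int[lebesgue_measure]_(v in `[- alpha N, alpha N]) T2 v)
     =o_\oo (fun N : nat => (ln (N%:R : R))^-1) ->
   ((exists l : R,
       ('E_P[renormalized_energy N \o X])%E @[N --> \oo] --> l%:E) <->
    improper_converges (fun v => T2 v * ln `|v|)) /\
   (forall J : R, improper_integral (fun v => T2 v * ln `|v|) J ->
     ('E_P[renormalized_energy N \o X])%E @[N --> \oo] --> (ln (2 * pi) + J)%:E)).
Proof.
have [M T2_le] := T2_bounded.
have corr1 := X_rho 1%N isT; have corr2 := X_rho 2%N isT.
have mT2 := measurable_T2 corr2 rho2.
have mln : measurable_fun [set: R] (fun v : R => ln `|v|) by exact: measurableT_comp.
have lnN (v : R) : ln `|- v| = ln `|v| by rewrite normrN.
have symL (A : R) : \int[lebesgue_measure]_(v in `[- A, 0]) (T2 v * ln `|v|) =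
    \int[lebesgue_measure]_(v in `[0, A]) (T2 v * ln `|v|).
  exact: (Rintegral_T2_sym corr2 rho2 T2_le mln lnN (integrable_ln_norm A)).
have iT := integrable_T2 corr2 rho2 T2_le.
have symT (A : R) : \int[lebesgue_measure]_(v in `[- A, 0]) T2 v =
    \int[lebesgue_measure]_(v in `[0, A]) T2 v.
  have := Rintegral_T2_sym corr2 rho2 T2_le (measurable_cst (1 : R)) (fun=> erefl)
    (integrable_cst_itv 0 A 1).
  by under eq_Rintegral do rewrite mulr1; under [in RHS]eq_Rintegral do rewrite mulr1.
have al_oo := cvg_alpha alpha_gt0 ln_alpha.
pose Psi A := density_primitive (T2 := T2) A; pose Phi A := log_primitive (T2 := T2) A.
pose W (N : nat) : R :=
  triangle_integral (fun v => T2 v * logsin N%:R v) N%:R / N%:R + ln N%:R.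
have EW : \forall N \near \oo, (W N)%:E = ('E_P[renormalized_energy N \o X])%E.
  near=> N; rewrite (expected_energy X_process corr2 rho2 T2_le)//.
  by near: N; exact: nbhs_infty_gt.
have asym := energy_asymptotics mT2 T2_le eps_gt0 alpha_gt0 ln_alpha alpha_pow T2_log_sin.
rewrite -/W in asym.
have PhiJ J : improper_integral (fun v => T2 v * ln `|v|) J ->
    Phi (alpha N) @[N --> \oo] --> J / 2.
  by move=> /(improper_even (fun A _ => symL A)) h; apply: cvg_comp al_oo h.
have PsiA c : improper_integral T2 c -> Psi A @[A --> +oo] --> c / 2.
  exact: (improper_even (fun A _ => symT A)).
have PsiJ c : improper_integral T2 c -> Psi (alpha N) @[N --> \oo] --> c / 2.
  by move=> /PsiA h; apply: cvg_comp al_oo h.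
split.
- move=> c [J HJ] Hc c1.
  (* The leading term is about (1 - c) ln N, so its sign matters. The number variance gives 2 (c /
     2) <= 1. *)
  have {}c1 : c < 1.
    rewrite lt_neqAle c1/=.
    have := triangle_T2_average_le X_process corr1 corr2 rho1 rho2 T2_le (PsiA c Hc).
    lra.
  apply: cvg_trans (near_eq_cvg EW) _; apply/cvgeryP/cvgryPge => A.
  (* The limit of the energy with the term ln N (1 - 2 Psi) removed. *)
  pose l := 0 + (2 * ln (2 * pi) * (c / 2) + 2 * (J / 2)).
  have cl : (W N - (ln N%:R * (1 - 2 * Psi (alpha N)) +
      2 * ln (2 * pi) * Psi (alpha N) + 2 * Phi (alpha N))) +
      (2 * ln (2 * pi) * Psi (alpha N) + 2 * Phi (alpha N)) @[N --> \oo] --> l.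
    apply: cvgD; first exact: asym.
    by apply: cvgD; apply: cvgM; [exact: cvg_cst|exact: PsiJ|exact: cvg_cst|exact: PhiJ].
  (* Half of the gap: once Psi is within k / 2 of c / 2, 1 - 2 Psi >= (1 - c) - k = k. *)
  pose k := (1 - c) / 2; have k0 : 0 < k by rewrite divr_gt0 ?subr_gt0.
  near=> N.
  have h1 : `|l - ((W N - (ln N%:R * (1 - 2 * Psi (alpha N)) +
      2 * ln (2 * pi) * Psi (alpha N) + 2 * Phi (alpha N))) +
      (2 * ln (2 * pi) * Psi (alpha N) + 2 * Phi (alpha N)))| <= 1.
    by near: N; move/cvgrPdist_le : cl; apply.
  have h2 : `|c / 2 - Psi (alpha N)| <= k / 2.
    by near: N; move/cvgrPdist_le : (PsiJ c Hc); apply; rewrite divr_gt0.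
  have h3 : `|A| + `|l| + 1 <= k * ln N%:R.
    rewrite mulrC -ler_pdivrMr//.
    by near: N; move/cvgryPge : (@cvg_ln_nat R); exact.
  have h4 : 0 <= ln (N%:R : R).
    by near: N; move/cvgryPge : (@cvg_ln_nat R); exact.
  have h5 : k * ln N%:R <= ln N%:R * (1 - 2 * Psi (alpha N)).
    rewrite mulrC ler_wpM2l//; move: h2; rewrite ler_norml /k => /andP[? ?]; lra.
  move: h1 h3 h5; rewrite ler_norml; have := ler_norm A; have := ler_norm (- l).
  rewrite normrN; move: (ln _ * (1 - _)) => y; move=> ? ? /andP[? ?] ? ?; lra.
- move=> H1 Ho.
  (* By symmetry the integral over [- alpha_N, alpha_N] is 2 Psi, so this is the rate assumption of
     (b) multiplied by ln N. *)
  have lnPsi : ln N%:R * (1 - 2 * Psi (alpha N)) @[N --> \oo] --> 0.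
    apply/cvgrPdist_le => e e0; near=> N.
    have l1 : 1 <= ln (N%:R : R).
      by near: N; move/cvgryPge : (@cvg_ln_nat R); exact.
    have a0 : 0 < alpha N by near: N.
    have : `|1 - \int[lebesgue_measure]_(v in `[- alpha N, alpha N]) T2 v| <=
        e * `|(ln (N%:R : R))^-1|.
      by near: N; have /eqoP/(_ e e0) := Ho.
    rewrite (@Rintegral_itv_split _ _ 0) ?oppr_le0//; [|exact: ltW..].
    rewrite symT -[Rintegral _ _ _]/(Psi (alpha N)).
    rewrite (_ : Psi _ + Psi _ = 2 * Psi (alpha N)); last by ring.
    rewrite sub0r normrN normrM normfV.
    have l0 : 0 < ln (N%:R : R) by lra.
    by rewrite (gtr0_norm l0) ler_pdivlMr// mulrC.
  have base : ln N%:R * (1 - 2 * Psi (alpha N)) + 2 * ln (2 * pi) * Psi (alpha N)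
      @[N --> \oo] --> ln (2 * pi).
    have := cvgD lnPsi (cvgM (cvg_cst (2 * ln (2 * pi))) (PsiJ 1 H1)).
    rewrite (_ : 0 + 2 * ln (2 * pi) * (1 / 2) = ln (2 * pi)); last by field.
    exact.
  have lim2 J : improper_integral (fun v => T2 v * ln `|v|) J ->
      ('E_P[renormalized_energy N \o X])%E @[N --> \oo] --> (ln (2 * pi) + J)%:E.
    move=> HJ; apply: cvg_trans (near_eq_cvg EW) _; apply/fine_cvgP.
    split; first exact: nearW.
    have h := cvgD (cvgD asym base) (cvgM (cvg_cst (2 : R)) (PhiJ J HJ)).
    rewrite (_ : ln (2 * pi) + J = 0 + ln (2 * pi) + 2 * (J / 2)); last by field.
    rewrite (_ : fine \o _ = (fun N => W N - (ln N%:R * (1 - 2 * Psi (alpha N)) +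
      2 * ln (2 * pi) * Psi (alpha N) + 2 * Phi (alpha N)) +
      (ln N%:R * (1 - 2 * Psi (alpha N)) + 2 * ln (2 * pi) * Psi (alpha N)) +
      2 * Phi (alpha N))); first exact: h.
    by apply/funext => N /=; ring.
  split => //; split; last first.
    by move=> [J HJ]; exists (ln (2 * pi) + J); exact: lim2.
  move=> [l Hl].
  have Wl : W N @[N --> \oo] --> l.
    have : (W N)%:E @[N --> \oo] --> l%:E.
      apply: cvg_trans Hl; apply: near_eq_cvg; move: EW; apply: filterS => N ->.
      by [].
    by move/fine_cvgP => [].
  (* Every other term of the expansion converges, so it can be solved for Phi. This gives a limit
     along [alpha N] only; [cvg_log_primitive] extends it to all A. *)
  have Phil : Phi (alpha N) @[N --> \oo] --> (l - ln (2 * pi)) / 2.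
    have h := cvgM (cvgB (cvgB Wl base) asym) (cvg_cst (2^-1 : R)).
    rewrite subr0 in h.
    rewrite (_ : (fun N => Phi _) = (fun N => (W N -
      (ln N%:R * (1 - 2 * Psi (alpha N)) + 2 * ln (2 * pi) * Psi (alpha N)) -
      (W N - (ln N%:R * (1 - 2 * Psi (alpha N)) +
      2 * ln (2 * pi) * Psi (alpha N) + 2 * Phi (alpha N)))) / 2)); first exact: h.
    by apply/funext => N /=; field.
  have := cvg_log_primitive mT2 T2_le eps_gt0 alpha_gt0 ln_alpha alpha_pow T2_log_sin Phil.
  move=> h; eexists; apply: (even_improper _ (fun A _ => symL A) h).
  apply: integrable_even_itv => A; last exact: (integrable_T2_ln mT2 T2_le).
  apply: (integrable_T2_mul corr2 rho2 T2_le) => //.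
  exact: even_integrable (integrable_ln_norm A).
Unshelve. all: by end_near. Qed.
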